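(* Let $p_1,p_2,q_1,q_2\in\mathbb{R}$ satisfy $|p_1|<|p_2|$, $|q_1|<|q_2|$ and $p_2^2+q_2^2<1$, and consider the flexible octahedron in $\mathbb{S}^3$ given by $$\begin{aligned} \mathbf{a}_1&=\Bigl(\tfrac{p_1}{\cos\theta},\delta_1\sqrt{1-\tfrac{p_1^2}{\cos^2\theta}},0,0\Bigr),& \mathbf{b}_1&=\Bigl(\tfrac{p_2}{\cos\theta},\delta_2\sqrt{1-\tfrac{p_2^2}{\cos^2\theta}},0,0\Bigr),\\ \mathbf{a}_2&=\Bigl(0,0,\tfrac{q_1}{\sin\theta},\varepsilon_1\sqrt{1-\tfrac{q_1^2}{\sin^2\theta}}\Bigr),& \mathbf{b}_2&=\Bigl(0,0,\tfrac{q_2}{\sin\theta},\varepsilon_2\sqrt{1-\tfrac{q_2^2}{\sin^2\theta}}\Bigr),\\ \mathbf{a}_3&=(\cos\theta,0,\sin\theta,0),&\mathbf{b}_3&=(\cos\theta,0,-\sin\theta,0). \end{aligned}$$ Then this flexible octahedron has the first kind with respect to each of the faces $\mathbf{a}_1\mathbf{a}_2\mathbf{a}_3$ and $\mathbf{a}_1\mathbf{a}_2\mathbf{b}_3$, the second kind with respect to each of the faces $\mathbf{a}_1\mathbf{b}_2\mathbf{a}_3$, $\mathbf{a}_1\mathbf{b}_2\mathbf{b}_3$, $\mathbf{b}_1\mathbf{a}_2\mathbf{a}_3$ and $\mathbf{b}_1\mathbf{a}_2\mathbf{b}_3$, and the third kind with respect to each of the faces $\mathbf{b}_1\mathbf{b}_2\mathbf{a}_3$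 and $\mathbf{b}_1\mathbf{b}_2\mathbf{b}_3$.
   Context: **Setting.** $\mathbb{S}^3$ is the unit sphere in $\mathbb{E}^4$. In the formulae $\delta_1,\delta_2,\varepsilon_1,\varepsilon_2\in\{-1,1\}$ and $\theta\in[\theta_{\min},\theta_{\max}]$, $\theta_{\min}=\arcsin|q_2|$, $\theta_{\max}=\arccos|p_2|$. During the (closed) flexion the signs $\delta_1,\varepsilon_1$ remain unchanged, $\delta_2$ changes when $\theta=\theta_{\max}$, and $\varepsilon_2$ changes when $\theta=\theta_{\min}$. The octahedron has as edges all pairs of vertices except $\{\mathbf{a}_i,\mathbf{b}_i\}$ and 8 faces $\mathbf{u}_1\mathbf{u}_2\mathbf{u}_3$, $\mathbf{u}_i\in\{\mathbf{a}_i,\mathbf{b}_i\}$; it is oriented so that $\mathbf{a}_1\mathbf{a}_2\mathbf{a}_3$ is positively oriented. **Oriented dihedral angles.** For an edge $\mathbf{u}\mathbf{v}$ with adjacent faces $\mathbf{u}\mathbf{v}\mathbf{w}_1,\mathbf{u}\mathbf{v}\mathbf{w}_2$ and a point $\mathbf{p}$ on it, let $\mathbf{m}_i$ be the exterior unit normal to the face $\mathbf{u}\mathbf{v}\mathbf{w}_i$ at $\mathbf{p}$ (normal orientation followed by the positive orientation of the face is the positive orientation of $\mathbb{S}^3$) and $\mathbf{n}_i$ the unit vector at $\mathbf{p}$ orthogonal to the edge, tangent to the face and pointing inside it. The oriented dihedral angle $\varphi_{\mathbf{u}\mathbf{v}}\in\mathbb{R}/2\pi\mathbb{Z}$ is the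 rotation angle around the edge from $\mathbf{n}_1$ to $\mathbf{n}_2$ in the direction for which $\mathbf{n}_1$ is obtained from $\mathbf{m}_1$ by rotation through $\pi/2$; $t_{\mathbf{u}\mathbf{v}}=\tan(\varphi_{\mathbf{u}\mathbf{v}}/2)\in\mathbb{R}\cup\{\infty\}$. **Kinds.** For a face $F=\mathbf{u}_1\mathbf{u}_2\mathbf{u}_3$, $\mathbf{u}_j\in\{\mathbf{a}_j,\mathbf{b}_j\}$, put $t_1=t_{\mathbf{u}_2\mathbf{u}_3}$, $t_2=t_{\mathbf{u}_3\mathbf{u}_1}$, $t_3=t_{\mathbf{u}_1\mathbf{u}_2}$. The flexible octahedron has the first, second or third kind with respect to $F$ if, up to transformations $t_j\mapsto\pm t_j^{\pm1}$ (chosen for each $j$) and possibly swapping the indices $1$ and $2$, the quantities $t_1,t_2,t_3$ are parametrized during the flexion by a parameter $u\in\mathbb{R}$ as follows, with some elliptic modulus $k\in(0,1)$ and nonzero real constants $\lambda_1,\lambda_2,\lambda_3$: - 1st kind: $t_1=\lambda_1\operatorname{dn}u$, $\;t_2=\lambda_2\operatorname{dn}\left(u-\frac K2\right)$, $\;t_3=\lambda_3\left(\operatorname{dn}u+\frac{k'}{\operatorname{dn}u}\right)$; - 2nd kind: $t_1=\lambda_1\operatorname{dn}u$, $\;t_2=\frac{\lambda_2\operatorname{cn}(u-K/2)}{\operatorname{sn}(u-K/2)}$, $\;t_3=\lambda_3\left(\operatorname{dn}u-\frac{k'}{\operatorname{dn}u}\right)$; - 3rd kind: $t_1=\frac{\lambda_1\operatorname{cn}u}{\operatorname{sn}u}$,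 $\;t_2=\frac{\lambda_2\operatorname{cn}(u-K/2)}{\operatorname{sn}(u-K/2)}$, $\;t_3=\lambda_3\left(\frac{\operatorname{cn}u}{\operatorname{sn}u}-\frac{k'\operatorname{sn}u}{\operatorname{cn}u}\right)$. Here $\operatorname{sn},\operatorname{cn},\operatorname{dn}$ are Jacobi's elliptic functions with modulus $k$, $k'=\sqrt{1-k^2}$, and $K=\int_0^1\frac{dx}{\sqrt{(1-x^2)(1-k^2x^2)}}$. *)

(* Defs.v *)
From Stdlib Require Export Reals.
From Coquelicot Require Export Coquelicot.
Open Scope R_scope.

(** * Euclidean 4-space *)

Definition vec4 : Type := (R * R * R * R)%type.

Definition vadd (v w : vec4) : vec4 :=
  match v, w with
  | (v1, v2, v3, v4), (w1, w2, w3, w4) => (v1 + w1, v2 + w2, v3 + w3, v4 + w4)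
  end.

Definition vscale (c : R) (v : vec4) : vec4 :=
  match v with (v1, v2, v3, v4) => (c * v1, c * v2, c * v3, c * v4) end.

Definition dot (v w : vec4) : R :=
  match v, w with
  | (v1, v2, v3, v4), (w1, w2, w3, w4) => v1 * w1 + v2 * w2 + v3 * w3 + v4 * w4
  end.

Definition det3 (a1 a2 a3 b1 b2 b3 c1 c2 c3 : R) : R :=
  a1 * (b2 * c3 - b3 * c2) - a2 * (b1 * c3 - b3 * c1) + a3 * (b1 * c2 - b2 * c1).

(** Determinant of the matrix with rows [a], [b], [c], [d], expanded along the
    first row. *)
Definition det4 (a b c d : vec4) : R :=
  match a, b, c, d with
  | (a1, a2, a3, a4), (b1, b2, b3, b4), (c1, c2, c3, c4), (d1, d2, d3, d4) =>
      a1 * det3 b2 b3 b4 c2 c3 c4 d2 d3 d4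
      - a2 * det3 b1 b3 b4 c1 c3 c4 d1 d3 d4
      + a3 * det3 b1 b2 b4 c1 c2 c4 d1 d2 d4
      - a4 * det3 b1 b2 b3 c1 c2 c3 d1 d2 d3
  end.

(** * Octahedra *)

Inductive index : Set := i1 | i2 | i3.

Definition next (j : index) : index :=
  match j with i1 => i2 | i2 => i3 | i3 => i1 end.

Inductive side : Set := sa | sb.

(** [P i sa] is the vertex a_i and [P i sb] is the vertex b_i. *)
Definition octahedron : Type := index -> side -> vec4.

(** The face u_1 u_2 u_3 is encoded by the choice of u_i among a_i, b_i. *)
Definition face : Type := index -> side.

Definition mkface (s1 s2 s3 : side) : face :=
  fun i => match i with i1 => s1 | i2 => s2 | i3 => s3 end.

(** The octahedral surface is oriented coherently, with a_1 a_2 a_3 positive: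
    replacing one a_i by b_i reverses the orientation, so u_1 u_2 u_3 in this
    order is positive iff the number of b's among the u_i is even. *)
Definition side_sign (s : side) : R :=
  match s with sa => 1 | sb => -1 end.

(** * Oriented dihedral angles

    Faces are spherical triangles, with vertices unit vectors of E^4.  For an
    edge uv and a point p on it, the normals and conormals below are tangent to S^3 at p and
    orthogonal to uv, i.e. orthogonal to both u and v, and none of the
    conditions depends on p. *)

(** [m] is the exterior unit normal to the face [u v w], where [sg] is 1 or -1
    according as (u, v, w) is the positive orientation of the face or not.
    A basis (x, y, z) of T_p S^3 is positive iff [det4 p x y z > 0]; at p = u the
    face is oriented by the projections to T_u S^3 of (v, w), and these
    projections can be replaced by v and w in the determinant. *)
Definition exterior_normal (sg : R) (u v w m : vec4) : Prop :=
  dot m m = 1 /\ dot m u = 0 /\ dot m v = 0 /\ dot m w = 0 /\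
  0 < sg * det4 u m v w.

(** [n] is the unit vector orthogonal to the edge [u v], tangent to the face
    [u v w] and pointing inside it. *)
Definition inner_conormal (u v w n : vec4) : Prop :=
  dot n n = 1 /\ dot n u = 0 /\ dot n v = 0 /\
  exists x y z : R,
    0 < z /\ n = vadd (vscale x u) (vadd (vscale y v) (vscale z w)).

(** [phi] represents in R / 2 pi Z the oriented dihedral angle at the edge [u v]
    with adjacent faces [u v w1] and [u v w2].  The rotation through pi/2 takes
    m1 to n1, hence n1 to - m1, so the one through [phi] takes n1 to
    (cos phi) n1 - (sin phi) m1. *)
Definition oriented_dihedral_angle (sg : R) (u v w1 w2 : vec4) (phi : R) : Prop :=
  exists m1 n1 n2 : vec4,
    exterior_normal sg u v w1 m1 /\
    inner_conormal u v w1 n1 /\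
    inner_conormal u v w2 n2 /\
    n2 = vadd (vscale (cos phi) n1) (vscale (- sin phi) m1).

(** * The projective line: [None] is the point at infinity *)

Definition RP1 : Type := option R.

Definition half_tan (phi : R) : RP1 :=
  if Req_EM_T (cos (phi / 2)) 0 then None else Some (tan (phi / 2)).

Definition Popp (t : RP1) : RP1 :=
  match t with Some x => Some (- x) | None => None end.

Definition Pinv (t : RP1) : RP1 :=
  match t with
  | Some x => if Req_EM_T x 0 then None else Some (/ x)
  | None => Some 0
  end.

(** Only used with [c <> 0]. *)
Definition Pscale (c : R) (t : RP1) : RP1 :=
  match t with Some x => Some (c * x) | None => None end.

(** Only used with [x], [y] not both zero. *)
Definition Pdiv (x y : R) : RP1 :=
  if Req_EM_T y 0 then None else Some (x / y).

(** Only used when at most one argument is infinite. *)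
Definition Psub (s t : RP1) : RP1 :=
  match s, t with Some x, Some y => Some (x - y) | _, _ => None end.

(** The transformations t |-> +- t^{+-1}. *)
Definition sign_inv (neg inv : bool) (t : RP1) : RP1 :=
  let t' := if inv then Pinv t else t in
  if neg then Popp t' else t'.

(** [edge_t P F j t]: t is the value of t_j for the face [F], that is, the
    half-angle tangent at the edge of [F] opposite to its j-th vertex.  As
    (j+1, j+2, j) is an even permutation of (1, 2, 3), the triple
    (u_{j+1}, u_{j+2}, a_j) has the sign given by the sides of u_{j+1}, u_{j+2}. *)
Definition edge_t (P : octahedron) (F : face) (j : index) (t : RP1) : Prop :=
  let j' := next j in
  let j'' := next j' in
  exists phi : R,
    oriented_dihedral_angle (side_sign (F j') * side_sign (F j''))
      (P j' (F j')) (P j'' (F j'')) (P j sa) (P j sb) phi /\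
    t = half_tan phi.

(** * Jacobi's elliptic functions of a real argument, with modulus [k] *)

(** The amplitude: the unique phi with
    u = int_0^phi dt / sqrt (1 - k^2 sin^2 t). *)
Definition am (k u : R) : R :=
  iota (fun phi : R =>
    is_RInt (fun t => / sqrt (1 - k ^ 2 * sin t ^ 2)) 0 phi u).

Definition sn (k u : R) : R := sin (am k u).
Definition cn (k u : R) : R := cos (am k u).
Definition dn (k u : R) : R := sqrt (1 - k ^ 2 * sn k u ^ 2).

Definition compl_modulus (k : R) : R := sqrt (1 - k ^ 2).

(** The complete integral is improper at 1. *)
Definition ellK (k : R) : R :=
  RInt_gen (fun x => / sqrt ((1 - x ^ 2) * (1 - k ^ 2 * x ^ 2)))
    (at_point 0) (at_left 1).

(** * Kinds of flexible octahedra *)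

(** The model functions, without the factors lambda_j. *)
Definition first_kind_fun (k u : R) (j : index) : RP1 :=
  match j with
  | i1 => Some (dn k u)
  | i2 => Some (dn k (u - ellK k / 2))
  | i3 => Some (dn k u + compl_modulus k / dn k u)
  end.

Definition second_kind_fun (k u : R) (j : index) : RP1 :=
  match j with
  | i1 => Some (dn k u)
  | i2 => Pdiv (cn k (u - ellK k / 2)) (sn k (u - ellK k / 2))
  | i3 => Some (dn k u - compl_modulus k / dn k u)
  end.

Definition third_kind_fun (k u : R) (j : index) : RP1 :=
  match j with
  | i1 => Pdiv (cn k u) (sn k u)
  | i2 => Pdiv (cn k (u - ellK k / 2)) (sn k (u - ellK k / 2))
  | i3 => Psub (Pdiv (cn k u) (sn k u))
               (Pdiv (compl_modulus k * sn k u) (cn k u))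
  end.

(** A flexion is given by the set of all positions of the octahedron. *)
Definition flexion : Type := octahedron -> Prop.

Definition parametrizes (g : R -> octahedron) (X : flexion) : Prop :=
  (forall (i : index) (s : side) (u : R), continuous (fun v : R => g v i s) u) /\
  (forall u : R, X (g u)) /\
  (forall P : octahedron, X P -> exists u : R, g u = P).

Definition swap12 (sw : bool) (j : index) : index :=
  if sw then match j with i1 => i2 | i2 => i1 | i3 => i3 end else j.

Definition has_kind (model : R -> R -> index -> RP1) (X : flexion) (F : face) : Prop :=
  exists (k : R) (lambda : index -> R) (neg inv : index -> bool) (sw : bool)
         (g : R -> octahedron),
    0 < k < 1 /\
    (forall j : index, lambda j <> 0) /\
    parametrizes g X /\
    forall (u : R) (j : index),
      edge_t (g u) F j
        (sign_inv (neg j) (inv j)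
           (Pscale (lambda (swap12 sw j)) (model k u (swap12 sw j)))).

Definition first_kind : flexion -> face -> Prop := has_kind first_kind_fun.
Definition second_kind : flexion -> face -> Prop := has_kind second_kind_fun.
Definition third_kind : flexion -> face -> Prop := has_kind third_kind_fun.

(** * The family of octahedra under consideration *)

Definition is_sign (e : R) : Prop := e = 1 \/ e = -1.

Definition octa (p1 p2 q1 q2 d1 d2 e1 e2 theta : R) : octahedron :=
  fun i s =>
    match i, s with
    | i1, sa => (p1 / cos theta, d1 * sqrt (1 - p1 ^ 2 / cos theta ^ 2), 0, 0)
    | i1, sb => (p2 / cos theta, d2 * sqrt (1 - p2 ^ 2 / cos theta ^ 2), 0, 0)
    | i2, sa => (0, 0, q1 / sin theta, e1 * sqrt (1 - q1 ^ 2 / sin theta ^ 2))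
    | i2, sb => (0, 0, q2 / sin theta, e2 * sqrt (1 - q2 ^ 2 / sin theta ^ 2))
    | i3, sa => (cos theta, 0, sin theta, 0)
    | i3, sb => (cos theta, 0, - sin theta, 0)
    end.

(** The signs [d1], [e1] are fixed.  The positions with different [d2] (resp.
    [e2]) coincide only at theta = acos |p2| (resp. theta = asin |q2|), so along
    a continuous path the signs [d2], [e2] change only there. *)
Definition octa_flexion (p1 p2 q1 q2 d1 e1 : R) : flexion :=
  fun P =>
    exists theta d2 e2 : R,
      asin (Rabs q2) <= theta <= acos (Rabs p2) /\
      is_sign d2 /\ is_sign e2 /\
      P = octa p1 p2 q1 q2 d1 d2 e1 e2 theta.

(* Main.v *)
Require Import Defs.
From Stdlib Require Import Ranalysis5 Lra FunctionalExtensionality.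

(* Let f_i be the second coordinates of a_1, b_1 times cos theta and g_i the fourth coordinates of
   a_2, b_2 times sin theta, so that f_i^2 = cos^2 theta - p_i^2 and g_i^2 = sin^2 theta - q_i^2.
   The cross ratio of p_1^2, p_2^2, 1 - q_1^2, 1 - q_2^2 determines a modulus m such that
   (f_1, f_2, g_1, g_2) is proportional to (dn, cn, 1, sn) of modulus m, up to constant factors.
   The descending Landen transformation expresses these by Jacobi functions of the modulus k with
   m = (1 - k')/(1 + k').  Up to constant factors t_3 is g/f, while t_1, which depends on u_2 only,
   is 1/dn u for u_2 = a_2 and sn u/cn u for u_2 = b_2.
   Exchanging the p_i with the q_i and the f_i with the g_i corresponds to u |-> K/2 - u, which
   gives t_2. *)

(** * Jacobi's elliptic functions *)

(** The relations f_i^2 + g_j^2 = 1 - p_i^2 - q_j^2 stand in for theta together with the two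
    variable signs. Since f_1 and g_1 never vanish, they carry the constant signs [d1] and [e1]; f_2
    and g_2 change sign with cn and sn of modulus m, which makes [d2] and [e2] part of one
    continuous parametrization. The cross ratio is what makes these relations compatible with sn^2 +
    cn^2 = 1 and dn^2 = 1 - m^2 sn^2. Landen's transformation is forced by t_1: the half angle
    between the projections of a_1 and b_1 has a tangent proportional to 1/(dn + m cn) for u_2 = a_2
    and to sn/(dn + cn) for u_2 = b_2, all of modulus m, and in terms of modulus k each of these
    collapses to a single simple quotient. In the argument U = (1 + k')u of modulus m, the map u |->
    K/2 - u is U |-> K_m - U, where K_m is the complete integral of modulus m. The functions of
    modulus m transform simply under it, so t_2 needs no computation of its own. *)

Definition ellF (k phi : R) : R :=
  RInt (fun t => / sqrt (1 - k ^ 2 * sin t ^ 2)) 0 phi.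

Lemma sin2_le_1 (t : R) : 0 <= sin t ^ 2 <= 1.
Proof. pose proof (sin2_cos2 t) as H. unfold Rsqr in H. nra. Qed.

Lemma modulus_pos (k t : R) : 0 < k < 1 -> 0 < 1 - k ^ 2 * sin t ^ 2.
Proof. intros hk. pose proof (sin2_le_1 t). nra. Qed.

Lemma modulus_sqrt_bounds (k t : R) :
  0 < k < 1 -> 0 < sqrt (1 - k ^ 2 * sin t ^ 2) <= 1.
Proof.
  intros hk. pose proof (modulus_pos k t hk). split.
  - now apply sqrt_lt_R0.
  - rewrite <- sqrt_1 at 2. apply sqrt_le_1_alt. pose proof (sin2_le_1 t). nra.
Qed.

Lemma ellF_integrand_continuous (k t : R) :
  0 < k < 1 -> continuous (fun t => / sqrt (1 - k ^ 2 * sin t ^ 2)) t.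
Proof.
  intros hk. pose proof (modulus_pos k t hk) as Hp.
  pose proof (modulus_sqrt_bounds k t hk) as Hb.
  apply (ex_derive_continuous (V := R_NormedModule)). auto_derive.
  replace (1 + - (k * (k * 1) * (sin t * (sin t * 1)))) with (1 - k ^ 2 * sin t ^ 2)
    by ring.
  repeat split; lra.
Qed.

Lemma ex_RInt_ellF (k a b : R) :
  0 < k < 1 -> ex_RInt (fun t => / sqrt (1 - k ^ 2 * sin t ^ 2)) a b.
Proof.
  intros hk. apply (ex_RInt_continuous (V := R_CompleteNormedModule)).
  intros; now apply ellF_integrand_continuous.
Qed.

Lemma is_derive_ellF (k phi : R) :
  0 < k < 1 -> is_derive (ellF k) phi (/ sqrt (1 - k ^ 2 * sin phi ^ 2)).
Proof.
  intros hk.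
  apply (is_derive_RInt (V := R_NormedModule)
           (fun t => / sqrt (1 - k ^ 2 * sin t ^ 2)) (ellF k) 0).
  - apply filter_forall. intros x. apply (RInt_correct (V := R_CompleteNormedModule)).
    now apply ex_RInt_ellF.
  - now apply ellF_integrand_continuous.
Qed.

Lemma ellF_0 (k : R) : ellF k 0 = 0.
Proof. unfold ellF. now rewrite RInt_point. Qed.

(** The integrand is at least 1. Injectivity and surjectivity of [ellF k] and the Lipschitz bound on
    its inverse [am k] all come from this inequality. *)
Lemma ellF_expanding (k a b : R) : 0 < k < 1 -> a <= b -> b - a <= ellF k b - ellF k a.
Proof.
  intros hk hab.
  destruct (MVT_gen (ellF k) a b (fun t => / sqrt (1 - k ^ 2 * sin t ^ 2))) as [c [_ Hc]].
  - intros; now apply is_derive_ellF.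
  - intros x _. apply derivable_continuous_pt. exists (/ sqrt (1 - k ^ 2 * sin x ^ 2)).
    now apply is_derive_Reals, is_derive_ellF.
  - rewrite Hc. pose proof (modulus_sqrt_bounds k c hk).
    assert (1 <= / sqrt (1 - k ^ 2 * sin c ^ 2)).
    { rewrite <- Rinv_1 at 1. apply Rinv_le_contravar; lra. }
    nra.
Qed.

Lemma ellF_lt (k a b : R) : 0 < k < 1 -> a < b -> ellF k a < ellF k b.
Proof. intros hk hab. pose proof (ellF_expanding k a b hk). lra. Qed.

Lemma ellF_inj (k a b : R) : 0 < k < 1 -> ellF k a = ellF k b -> a = b.
Proof.
  intros hk H. destruct (Rtotal_order a b) as [h | [h | h]]; auto.
  - pose proof (ellF_lt k a b hk h). lra.
  - pose proof (ellF_lt k b a hk h). lra.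
Qed.

Lemma continuity_ellF (k : R) : 0 < k < 1 -> continuity (ellF k).
Proof.
  intros hk x. apply derivable_continuous_pt. exists (/ sqrt (1 - k ^ 2 * sin x ^ 2)).
  now apply is_derive_Reals, is_derive_ellF.
Qed.

Lemma ellF_surj (k u : R) : 0 < k < 1 -> exists phi, ellF k phi = u.
Proof.
  intros hk.
  pose proof (ellF_expanding k 0 (Rabs u) hk (Rabs_pos u)) as H1.
  pose proof (ellF_expanding k (- Rabs u) 0 hk) as H2.
  rewrite ellF_0 in H1, H2. pose proof (Rabs_pos u).
  pose proof (Rle_abs u). pose proof (Rle_abs (- u)). rewrite Rabs_Ropp in *.
  destruct (IVT_gen (ellF k) (- Rabs u) (Rabs u) u) as [x [_ Hx]].
  - now apply continuity_ellF.
  - split.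
    + eapply Rle_trans; [apply Rmin_l | lra].
    + eapply Rle_trans; [ | apply Rmax_r]. lra.
  - now exists x.
Qed.

(** [iota] returns the unique upper limit with the given value of the integral; uniqueness is the
    injectivity of [ellF k]. *)
Lemma am_ellF (k phi : R) : 0 < k < 1 -> am k (ellF k phi) = phi.
Proof.
  intros hk. apply (iota_unique (V := R_CompleteNormedModule)).
  - intros y Hy. apply (ellF_inj k); auto.
    unfold ellF at 1. now apply is_RInt_unique.
  - apply (RInt_correct (V := R_CompleteNormedModule)). now apply ex_RInt_ellF.
Qed.

Lemma ellF_am (k u : R) : 0 < k < 1 -> ellF k (am k u) = u.
Proof.
  intros hk. destruct (ellF_surj k u hk) as [phi <-]. now rewrite am_ellF.
Qed.

Lemma am_nonexpanding (k u v : R) : 0 < k < 1 -> Rabs (am k v - am k u) <= Rabs (v - u).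
Proof.
  intros hk. rewrite <- (ellF_am k u hk) at 2. rewrite <- (ellF_am k v hk) at 2.
  set (a := am k u). set (b := am k v).
  destruct (Rle_or_lt a b) as [h | h].
  - pose proof (ellF_expanding k a b hk h). rewrite !Rabs_right; lra.
  - pose proof (ellF_expanding k b a hk). rewrite !Rabs_left; lra.
Qed.

Lemma continuity_am (k : R) : 0 < k < 1 -> continuity (am k).
Proof.
  intros hk u eps Heps. exists eps. split; [assumption | ].
  intros v [_ Hv]. simpl in *. unfold Rdist in *.
  eapply Rle_lt_trans; [now apply am_nonexpanding | exact Hv].
Qed.

Lemma am_le (k u v : R) : 0 < k < 1 -> u <= v -> am k u <= am k v.
Proof.
  intros hk huv. destruct (Rle_or_lt (am k u) (am k v)) as [h | h]; auto.
  pose proof (ellF_lt k _ _ hk h) as H. rewrite !ellF_am in H; lra.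
Qed.

(** Inverse function rule: the derivative of [ellF k] at [am k u] is the reciprocal of [dn k u]. *)
Lemma is_derive_am (k u : R) : 0 < k < 1 -> is_derive (am k) u (dn k u).
Proof.
  intros hk. pose proof (modulus_sqrt_bounds k (am k u) hk) as Hb.
  assert (Prf : forall a, am k (u - 1) <= a <= am k (u + 1) -> derivable_pt (ellF k) a).
  { intros a _. exists (/ sqrt (1 - k ^ 2 * sin a ^ 2)).
    now apply is_derive_Reals, is_derive_ellF. }
  assert (Hi : am k (u - 1) <= am k u <= am k (u + 1)) by (split; apply am_le; lra).
  assert (HD : derive_pt (ellF k) (am k u) (Prf (am k u) Hi)
               = / sqrt (1 - k ^ 2 * sin (am k u) ^ 2)).
  { apply derive_pt_eq_0. now apply is_derive_Reals, is_derive_ellF. }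
  apply is_derive_Reals.
  replace (dn k u) with (1 / derive_pt (ellF k) (am k u) (Prf (am k u) Hi)).
  - apply (derivable_pt_lim_recip_interv (ellF k) (am k) (u - 1) (u + 1)); try lra.
    + now apply continuity_am.
    + intros x _. now apply ellF_am.
    + rewrite HD. apply Rinv_neq_0_compat. lra.
  - rewrite HD. unfold dn, sn, Rdiv. rewrite Rinv_inv. ring.
Qed.

Lemma sn2_cn2 (k u : R) : cn k u ^ 2 = 1 - sn k u ^ 2.
Proof. unfold sn, cn. pose proof (sin2_cos2 (am k u)) as H. unfold Rsqr in H. lra. Qed.

Lemma dn_sq (k u : R) : 0 < k < 1 -> dn k u ^ 2 = 1 - k ^ 2 * sn k u ^ 2.
Proof. intros hk. apply pow2_sqrt. left. now apply modulus_pos. Qed.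

Lemma dn_pos (k u : R) : 0 < k < 1 -> 0 < dn k u.
Proof. intros hk. apply (modulus_sqrt_bounds k (am k u) hk). Qed.

Lemma is_derive_sn (k u : R) : 0 < k < 1 -> is_derive (sn k) u (cn k u * dn k u).
Proof.
  intros hk.
  replace (cn k u * dn k u) with (scal (dn k u) (cn k u))
    by (unfold scal; simpl; unfold mult; simpl; ring).
  apply (is_derive_comp sin (am k)).
  - unfold cn. apply is_derive_Reals, derivable_pt_lim_sin.
  - now apply is_derive_am.
Qed.

Lemma is_derive_cn (k u : R) : 0 < k < 1 -> is_derive (cn k) u (- sn k u * dn k u).
Proof.
  intros hk.
  replace (- sn k u * dn k u) with (scal (dn k u) (- sn k u))
    by (unfold scal; simpl; unfold mult; simpl; ring).
  apply (is_derive_comp cos (am k)).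
  - unfold sn. apply is_derive_Reals, derivable_pt_lim_cos.
  - now apply is_derive_am.
Qed.

Lemma is_derive_dn (k u : R) :
  0 < k < 1 -> is_derive (dn k) u (- k ^ 2 * sn k u * cn k u).
Proof.
  intros hk. pose proof (dn_pos k u hk) as Hd. unfold dn in Hd.
  pose proof (is_derive_sn k u hk) as Hs.
  unfold dn. evar_last.
  - apply is_derive_sqrt.
    + apply (is_derive_minus (V := R_NormedModule)); [apply is_derive_const | ].
      apply is_derive_scal. apply is_derive_pow. exact Hs.
    + now apply modulus_pos.
  - unfold minus, plus, opp, zero; simpl. fold (dn k u).
    replace (sqrt _) with (dn k u) by (unfold dn; f_equal; ring).
    assert (dn k u <> 0) by (unfold dn; lra). field. assumption.
Qed.

Lemma am_0 (k : R) : 0 < k < 1 -> am k 0 = 0.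
Proof. intros hk. rewrite <- (ellF_0 k) at 1. now apply am_ellF. Qed.

Lemma ellF_opp (k phi : R) : 0 < k < 1 -> ellF k (- phi) = - ellF k phi.
Proof.
  intros hk. unfold ellF.
  pose proof (RInt_comp_lin (V := R_CompleteNormedModule)
                (fun t => / sqrt (1 - k ^ 2 * sin t ^ 2)) (-1) 0 0 phi) as H.
  replace (-1 * 0 + 0) with 0 in H by ring.
  replace (-1 * phi + 0) with (- phi) in H by ring.
  rewrite <- H by now apply ex_RInt_ellF.
  rewrite (RInt_ext _ (fun y => opp (/ sqrt (1 - k ^ 2 * sin y ^ 2)))).
  - rewrite (RInt_opp (V := R_CompleteNormedModule)); [reflexivity | now apply ex_RInt_ellF].
  - intros x _. replace (-1 * x + 0) with (- x) by ring. rewrite sin_neg.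
    replace ((- sin x) ^ 2) with (sin x ^ 2) by ring.
    unfold scal, opp; simpl; unfold mult; simpl. ring.
Qed.

Lemma am_opp (k u : R) : 0 < k < 1 -> am k (- u) = - am k u.
Proof.
  intros hk. rewrite <- (ellF_am k u hk) at 1. rewrite <- ellF_opp by assumption.
  now apply am_ellF.
Qed.

Lemma sn_opp (k u : R) : 0 < k < 1 -> sn k (- u) = - sn k u.
Proof. intros hk. unfold sn. rewrite am_opp by assumption. apply sin_neg. Qed.

Lemma cn_opp (k u : R) : 0 < k < 1 -> cn k (- u) = cn k u.
Proof. intros hk. unfold cn. rewrite am_opp by assumption. apply cos_neg. Qed.

Lemma dn_opp (k u : R) : 0 < k < 1 -> dn k (- u) = dn k u.
Proof. intros hk. unfold dn. rewrite sn_opp by assumption. f_equal. ring. Qed.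

Lemma sn_0 (k : R) : 0 < k < 1 -> sn k 0 = 0.
Proof. intros hk. unfold sn. rewrite am_0 by assumption. apply sin_0. Qed.

Lemma cn_0 (k : R) : 0 < k < 1 -> cn k 0 = 1.
Proof. intros hk. unfold cn. rewrite am_0 by assumption. apply cos_0. Qed.

Lemma dn_0 (k : R) : 0 < k < 1 -> dn k 0 = 1.
Proof.
  intros hk. unfold dn. rewrite sn_0 by assumption.
  replace (1 - k ^ 2 * 0 ^ 2) with 1 by ring. apply sqrt_1.
Qed.

(** * The addition theorems *)

Lemma eq_of_derive_0 (f : R -> R) (a b : R) : (forall t, is_derive f t 0) -> f a = f b.
Proof.
  intros H. destruct (Rtotal_order a b) as [h | [-> | h]]; [ | easy | symmetry].
  all: apply (eq_is_derive (V := R_NormedModule)); [intros t _; apply H | assumption].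
Qed.

Lemma is_derive_div_0 (f g : R -> R) (x df dg : R) :
  is_derive f x df -> is_derive g x dg -> g x <> 0 -> df * g x = f x * dg ->
  is_derive (fun t => f t / g t) x 0.
Proof.
  intros Hf Hg H0 H. evar_last.
  - now apply is_derive_div; [apply Hf | apply Hg | ].
  - simpl. rewrite H. field. assumption.
Qed.

Lemma sn_sq_le_1 (k u : R) : 0 <= sn k u ^ 2 <= 1.
Proof. apply sin2_le_1. Qed.

Lemma addition_denom_pos (k u v : R) : 0 < k < 1 -> 0 < 1 - k ^ 2 * sn k u ^ 2 * sn k v ^ 2.
Proof.
  intros hk. pose proof (sn_sq_le_1 k u). pose proof (sn_sq_le_1 k v).
  assert (0 <= sn k u ^ 2 * sn k v ^ 2 <= 1) by nra. nra.
Qed.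

Lemma Derive_sn (k u : R) : 0 < k < 1 -> Derive (fun x => sn k x) u = cn k u * dn k u.
Proof. intros hk. now apply is_derive_unique, is_derive_sn. Qed.

Lemma Derive_cn (k u : R) : 0 < k < 1 -> Derive (fun x => cn k x) u = - sn k u * dn k u.
Proof. intros hk. now apply is_derive_unique, is_derive_cn. Qed.

Lemma Derive_dn (k u : R) :
  0 < k < 1 -> Derive (fun x => dn k x) u = - k ^ 2 * sn k u * cn k u.
Proof. intros hk. now apply is_derive_unique, is_derive_dn. Qed.

Ltac jacobi_derive k hk :=
  auto_derive;
  [ repeat split;
    match goal with
    | |- ex_derive (fun x => sn k x) _ => eexists; now apply is_derive_sn
    | |- ex_derive (fun x => cn k x) _ => eexists; now apply is_derive_cn
    | |- ex_derive (fun x => dn k x) _ => eexists; now apply is_derive_dn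
    end
  | unfold Rminus;
    repeat match goal with
    | |- context [Derive (fun x => sn k x) ?u] => rewrite (Derive_sn k u hk)
    | |- context [Derive (fun x => cn k x) ?u] => rewrite (Derive_cn k u hk)
    | |- context [Derive (fun x => dn k x) ?u] => rewrite (Derive_dn k u hk)
    end; ring ].

Section Sum_fixed.

Context (k w : R) (hk : 0 < k < 1).

Lemma is_derive_addition_denom (x : R) :
  is_derive (fun x => 1 - k ^ 2 * sn k x ^ 2 * sn k (w - x) ^ 2) x
    (- 2 * k ^ 2 * sn k x * sn k (w - x) *
     (cn k x * dn k x * sn k (w - x) - sn k x * cn k (w - x) * dn k (w - x))).
Proof. jacobi_derive k hk. Qed.

Let sn_num (x : R) := sn k x * cn k (w - x) * dn k (w - x) + sn k (w - x) * cn k x * dn k x.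
Let cn_num (x : R) := cn k x * cn k (w - x) - sn k x * dn k x * sn k (w - x) * dn k (w - x).
Let dn_num (x : R) :=
  dn k x * dn k (w - x) - k ^ 2 * sn k x * cn k x * sn k (w - x) * cn k (w - x).

Lemma is_derive_sn_num (x : R) :
  is_derive sn_num x
    (sn k x * sn k (w - x) *
     (dn k (w - x) ^ 2 + k ^ 2 * cn k (w - x) ^ 2 - dn k x ^ 2 - k ^ 2 * cn k x ^ 2)).
Proof. unfold sn_num. jacobi_derive k hk. Qed.

Lemma is_derive_cn_num (x : R) :
  is_derive cn_num x
    (- sn k x * dn k x * cn k (w - x) + cn k x * sn k (w - x) * dn k (w - x)
     + sn k x * dn k x * cn k (w - x) * dn k (w - x) ^ 2
     - cn k x * dn k x ^ 2 * sn k (w - x) * dn k (w - x)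
     + k ^ 2 * sn k x ^ 2 * cn k x * sn k (w - x) * dn k (w - x)
     - k ^ 2 * sn k x * dn k x * sn k (w - x) ^ 2 * cn k (w - x)).
Proof. unfold cn_num. jacobi_derive k hk. Qed.

Lemma is_derive_dn_num (x : R) :
  is_derive dn_num x
    (- k ^ 2 * sn k x * cn k x * dn k (w - x) + k ^ 2 * dn k x * sn k (w - x) * cn k (w - x)
     - k ^ 2 * cn k x ^ 2 * dn k x * sn k (w - x) * cn k (w - x)
     + k ^ 2 * sn k x ^ 2 * dn k x * sn k (w - x) * cn k (w - x)
     + k ^ 2 * sn k x * cn k x * cn k (w - x) ^ 2 * dn k (w - x)
     - k ^ 2 * sn k x * cn k x * sn k (w - x) ^ 2 * dn k (w - x)).
Proof. unfold dn_num. jacobi_derive k hk. Qed.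

(** With the sum w of the two arguments fixed, the quotient in an addition formula depends on x
    alone, and the second hypothesis says that its derivative vanishes. At x = w the other argument
    is 0, so the denominator there is 1. *)
Lemma addition_quotient_const (num dnum : R -> R) (u : R) :
  (forall x, is_derive num x (dnum x)) ->
  (forall x, dnum x * (1 - k ^ 2 * sn k x ^ 2 * sn k (w - x) ^ 2) =
     num x * (- 2 * k ^ 2 * sn k x * sn k (w - x) *
     (cn k x * dn k x * sn k (w - x) - sn k x * cn k (w - x) * dn k (w - x)))) ->
  num u / (1 - k ^ 2 * sn k u ^ 2 * sn k (w - u) ^ 2) = num w.
Proof.
  intros Hd H.
  rewrite (eq_of_derive_0 (fun x => num x / (1 - k ^ 2 * sn k x ^ 2 * sn k (w - x) ^ 2)) u w).
  - rewrite Rminus_diag, sn_0 by assumption. field.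
  - intros x. eapply is_derive_div_0.
    + apply Hd.
    + apply is_derive_addition_denom.
    + apply Rgt_not_eq, addition_denom_pos, hk.
    + apply H.
Qed.

Lemma sn_sum_fixed (u : R) :
  sn k w = sn_num u / (1 - k ^ 2 * sn k u ^ 2 * sn k (w - u) ^ 2).
Proof.
  symmetry. erewrite addition_quotient_const.
  - unfold sn_num. rewrite Rminus_diag, sn_0, cn_0, dn_0 by assumption. ring.
  - apply is_derive_sn_num.
  - intros x. simpl. unfold sn_num.
    (* The identity holds modulo cn^2 = 1 - sn^2 and dn^2 = 1 - k^2 sn^2 at both arguments, which
       [ring] uses as rewriting rules. *)
    pose proof (sn2_cn2 k x) as H1. pose proof (sn2_cn2 k (w - x)) as H2.
    pose proof (dn_sq k x hk) as H3. pose proof (dn_sq k (w - x) hk) as H4.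
    ring [H1 H2 H3 H4].
Qed.

Lemma cn_sum_fixed (u : R) :
  cn k w = cn_num u / (1 - k ^ 2 * sn k u ^ 2 * sn k (w - u) ^ 2).
Proof.
  symmetry. erewrite addition_quotient_const.
  - unfold cn_num. rewrite Rminus_diag, sn_0, cn_0, dn_0 by assumption. ring.
  - apply is_derive_cn_num.
  - intros x. simpl. unfold cn_num.
    pose proof (sn2_cn2 k x) as H1. pose proof (sn2_cn2 k (w - x)) as H2.
    pose proof (dn_sq k x hk) as H3. pose proof (dn_sq k (w - x) hk) as H4.
    ring [H1 H2 H3 H4].
Qed.

Lemma dn_sum_fixed (u : R) :
  dn k w = dn_num u / (1 - k ^ 2 * sn k u ^ 2 * sn k (w - u) ^ 2).
Proof.
  symmetry. erewrite addition_quotient_const.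
  - unfold dn_num. rewrite Rminus_diag, sn_0, cn_0, dn_0 by assumption. ring.
  - apply is_derive_dn_num.
  - intros x. simpl. unfold dn_num.
    pose proof (sn2_cn2 k x) as H1. pose proof (sn2_cn2 k (w - x)) as H2.
    pose proof (dn_sq k x hk) as H3. pose proof (dn_sq k (w - x) hk) as H4.
    ring [H1 H2 H3 H4].
Qed.

End Sum_fixed.

Lemma sn_sub (k w u : R) : 0 < k < 1 ->
  sn k (w - u) =
  (sn k w * cn k u * dn k u - sn k u * cn k w * dn k w) / (1 - k ^ 2 * sn k w ^ 2 * sn k u ^ 2).
Proof.
  intros hk. rewrite (sn_sum_fixed k (w - u) hk w). replace (w - u - w) with (- u) by ring.
  rewrite sn_opp, cn_opp, dn_opp by assumption. f_equal; ring.
Qed.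

Lemma cn_sub (k w u : R) : 0 < k < 1 ->
  cn k (w - u) =
  (cn k w * cn k u + sn k w * dn k w * sn k u * dn k u) / (1 - k ^ 2 * sn k w ^ 2 * sn k u ^ 2).
Proof.
  intros hk. rewrite (cn_sum_fixed k (w - u) hk w). replace (w - u - w) with (- u) by ring.
  rewrite sn_opp, cn_opp, dn_opp by assumption. f_equal; ring.
Qed.

Lemma dn_sub (k w u : R) : 0 < k < 1 ->
  dn k (w - u) =
  (dn k w * dn k u + k ^ 2 * sn k w * cn k w * sn k u * cn k u) /
  (1 - k ^ 2 * sn k w ^ 2 * sn k u ^ 2).
Proof.
  intros hk. rewrite (dn_sum_fixed k (w - u) hk w). replace (w - u - w) with (- u) by ring.
  rewrite sn_opp, cn_opp, dn_opp by assumption. f_equal; ring.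
Qed.

(** * The complete integral and the values at its half *)

Lemma is_RInt_algebraic_ellF (k b : R) : 0 < k < 1 -> 0 <= b < 1 ->
  is_RInt (fun x => / sqrt ((1 - x ^ 2) * (1 - k ^ 2 * x ^ 2))) 0 b (ellF k (asin b)).
Proof.
  intros hk hb.
  assert (Hp : forall x, 0 <= x <= b -> 0 < 1 - x ^ 2 /\ 0 < 1 - k ^ 2 * x ^ 2).
  { intros x hx. assert (0 <= x ^ 2 < 1) by nra. split; nra. }
  replace (ellF k (asin b)) with (minus (ellF k (asin b)) (ellF k (asin 0)))
    by (rewrite asin_0, ellF_0; unfold minus, plus, opp; simpl; ring).
  (* The substitution x = sin t: [ellF k (asin x)] is an antiderivative, and b < 1 keeps [asin]
     differentiable. *)
  apply (is_RInt_derive (V := R_CompleteNormedModule) (fun x => ellF k (asin x))).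
  - intros x. rewrite Rmin_left, Rmax_right by lra. intros hx.
    destruct (Hp x hx) as [h1 h2]. evar_last.
    + apply (is_derive_comp (ellF k) asin).
      * now apply is_derive_ellF.
      * assert (hx' : -1 < x < 1) by lra.
        apply is_derive_Reals. apply (derive_pt_eq_1 _ _ _ (derivable_pt_asin x hx')).
        apply derive_pt_asin.
    + rewrite sin_asin by lra. unfold scal; simpl; unfold mult; simpl.
      rewrite sqrt_mult by lra. rewrite Rinv_mult. unfold Rsqr, Rdiv.
      replace (x * x) with (x ^ 2) by ring. simpl. ring.
  - intros x. rewrite Rmin_left, Rmax_right by lra. intros hx.
    destruct (Hp x hx) as [h1 h2].
    apply (ex_derive_continuous (V := R_NormedModule)). auto_derive.
    replace ((1 + - (x * (x * 1))) * (1 + - (k * (k * 1) * (x * (x * 1)))))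
      with ((1 - x ^ 2) * (1 - k ^ 2 * x ^ 2)) by ring.
    assert (0 < (1 - x ^ 2) * (1 - k ^ 2 * x ^ 2)) by now apply Rmult_lt_0_compat.
    repeat split; try lra. apply Rgt_not_eq, sqrt_lt_R0. assumption.
Qed.

(** The proper integrals up to y < 1 equal [ellF k (asin y)], and [ellF k] is continuous at PI/2, so
    they converge to its value there. *)
Lemma ellK_eq (k : R) : 0 < k < 1 -> ellK k = ellF k (PI / 2).
Proof.
  intros hk. unfold ellK.
  apply (is_RInt_gen_unique (V := R_CompleteNormedModule) (Fa := at_point 0) (Fb := at_left 1)).
  intros P [eps HP]. pose proof PI_RGT_0.
  assert (Hc : continuous (ellF k) (PI / 2)).
  { apply continuity_pt_filterlim. now apply continuity_ellF. }
  destruct (proj1 (filterlim_locally _ _) Hc eps) as [del Hdel].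
  (* For y above sin(PI/2 - e), [asin y] is within e < [del] of PI/2. The cap PI/2 keeps PI/2 - e in
     the range where sin increases. *)
  set (e := Rmin (del / 2) (PI / 2)).
  assert (he : 0 < e <= PI / 2 /\ e < del).
  { unfold e. pose proof (cond_pos del). pose proof (Rmin_l (del / 2) (PI / 2)).
    pose proof (Rmin_r (del / 2) (PI / 2)).
    assert (0 < Rmin (del / 2) (PI / 2)) by (apply Rmin_glb_lt; lra). lra. }
  assert (hs : sin (PI / 2 - e) < 1).
  { rewrite <- sin_PI2. apply sin_increasing_1; lra. }
  apply (Filter_prod _ _ _ (fun x => x = 0) (fun y => 0 <= y < 1 /\ sin (PI / 2 - e) < y)).
  - reflexivity.
  (* The second bound 1 on the radius keeps y positive. *)
  - assert (hd : 0 < Rmin (1 - sin (PI / 2 - e)) 1) by (apply Rmin_glb_lt; lra).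
    exists (mkposreal _ hd). intros y Hy hy1. unfold ball in Hy; simpl in Hy.
    unfold AbsRing_ball, abs, minus, plus, opp in Hy; simpl in Hy.
    pose proof (Rmin_l (1 - sin (PI / 2 - e)) 1). pose proof (Rmin_r (1 - sin (PI / 2 - e)) 1).
    apply Rabs_def2 in Hy. lra.
  - intros x y -> [hy hy']. exists (ellF k (asin y)). split.
    + now apply is_RInt_algebraic_ellF.
    + apply HP, Hdel. unfold ball; simpl.
      unfold AbsRing_ball, abs, minus, plus, opp; simpl.
      pose proof (asin_bound y). destruct (Rle_or_lt (asin y) (PI / 2 - e)) as [h | h].
      * exfalso. assert (sin (asin y) <= sin (PI / 2 - e)) by (apply sin_incr_1; lra).
        rewrite sin_asin in *; lra.
      * apply Rabs_def1; lra.
Qed.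

Lemma compl_modulus_sq (k : R) : 0 < k < 1 -> compl_modulus k ^ 2 = 1 - k ^ 2.
Proof. intros hk. apply pow2_sqrt. nra. Qed.

Lemma compl_modulus_bounds (k : R) : 0 < k < 1 -> 0 < compl_modulus k < 1.
Proof.
  intros hk. pose proof (compl_modulus_sq k hk).
  assert (0 < compl_modulus k) by (apply sqrt_lt_R0; nra). nra.
Qed.

(** Writing K = K/2 - (-K/2) in the subtraction formula for cn, cn K = 0 gives C^2 = S^2 D^2.
    Together with the relations between the squares this is a quadratic equation for S^2 with roots
    1/(1 + k') and 1/(1 - k'), and the second root exceeds 1. *)
Lemma half_K (k : R) : 0 < k < 1 ->
  let S := sn k (ellK k / 2) in let C := cn k (ellK k / 2) in let D := dn k (ellK k / 2) in
  0 < S /\ 0 < C /\ 0 < D /\ S ^ 2 = 1 / (1 + compl_modulus k) /\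
  C ^ 2 = compl_modulus k / (1 + compl_modulus k) /\ D ^ 2 = compl_modulus k /\
  C = S * D.
Proof.
  intros hk S C D. pose proof (compl_modulus_bounds k hk) as Hk'.
  pose proof (compl_modulus_sq k hk) as Hk2. set (k' := compl_modulus k) in *.
  pose proof PI_RGT_0 as Hpi.
  assert (HK : am k (ellK k) = PI / 2) by (rewrite ellK_eq by assumption; now apply am_ellF).
  assert (HKpos : 0 < ellK k).
  { rewrite ellK_eq by assumption. rewrite <- (ellF_0 k). apply ellF_lt; lra. }
  assert (Ham : 0 < am k (ellK k / 2) < PI / 2).
  { split.
    - rewrite <- (am_0 k hk) at 1. destruct (am_le k 0 (ellK k / 2) hk ltac:(lra)) as [h | h]; auto.
      apply (f_equal (ellF k)) in h. rewrite !ellF_am in h; lra.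
    - rewrite <- HK. destruct (am_le k (ellK k / 2) (ellK k) hk ltac:(lra)) as [h | h]; auto.
      apply (f_equal (ellF k)) in h. rewrite !ellF_am in h; lra. }
  assert (HS : 0 < S) by (apply sin_gt_0; lra).
  assert (HC : 0 < C) by (apply cos_gt_0; lra).
  assert (HD : 0 < D) by now apply dn_pos.
  pose proof (sn2_cn2 k (ellK k / 2)) as H1. pose proof (dn_sq k (ellK k / 2) hk) as H2.
  pose proof (cn_opp k (ellK k / 2) hk) as H3. pose proof (dn_opp k (ellK k / 2) hk) as H4.
  pose proof (sn_opp k (ellK k / 2) hk) as H5.
  assert (Hcn : cn k (ellK k) = 0) by (unfold cn; rewrite HK; apply cos_PI2).
  pose proof (cn_sub k (ellK k / 2) (- (ellK k / 2)) hk) as H.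
  pose proof (addition_denom_pos k (ellK k / 2) (ellK k / 2) hk) as Hden.
  replace (ellK k / 2 - - (ellK k / 2)) with (ellK k) in H by field.
  rewrite Hcn, H3, H4, H5 in H. fold S C D in H, H1, H2, Hden.
  clearbody S C D. clear H3 H4 H5 Hcn Ham HK.
  replace (1 - k ^ 2 * S ^ 2 * (- S) ^ 2) with (1 - k ^ 2 * S ^ 2 * S ^ 2) in H by ring.
  assert (HCSD : C = S * D).
  { assert (H' : C * C + S * D * - S * D = 0).
    { symmetry in H. apply Rmult_integral in H. destruct H as [H | H]; [exact H | ].
      exfalso. revert H. apply Rinv_neq_0_compat. lra. }
    assert ((C - S * D) * (C + S * D) = 0) by (rewrite <- H'; ring).
    assert (0 < S * D) by now apply Rmult_lt_0_compat.
    apply Rmult_integral in H0. lra. }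
  assert (HS2 : S ^ 2 = 1 / (1 + k')).
  { assert (Hq : ((1 + k') * S ^ 2 - 1) * ((1 - k') * S ^ 2 - 1) = 0).
    { replace (((1 + k') * S ^ 2 - 1) * ((1 - k') * S ^ 2 - 1))
        with ((1 - k' ^ 2) * S ^ 2 * S ^ 2 - 2 * S ^ 2 + 1) by ring.
      rewrite Hk2. rewrite HCSD in H1.
      replace ((S * D) ^ 2) with (S ^ 2 * D ^ 2) in H1 by ring. rewrite H2 in H1. nra. }
    apply Rmult_integral in Hq. destruct Hq as [Hq | Hq].
    - field_simplify_eq; lra.
    - exfalso. assert (S ^ 2 < 1) by nra. nra. }
  assert (HD2 : D ^ 2 = k').
  { rewrite H2, HS2. replace (k ^ 2) with (1 - k' ^ 2) by lra. field. lra. }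
  repeat split; auto. rewrite H1, HS2. field. lra.
Qed.

(* By the descending Landen transformation these are dn, cn and sn of the argument [(1 + k') u]
   for the modulus [(1 - k') / (1 + k')]. *)
Definition landen_dn (k u : R) : R :=
  (dn k u + compl_modulus k / dn k u) / (1 + compl_modulus k).
Definition landen_cn (k u : R) : R :=
  (dn k u - compl_modulus k / dn k u) / (1 - compl_modulus k).
Definition landen_sn (k u : R) : R := (1 + compl_modulus k) * sn k u * cn k u / dn k u.
Definition landen_modulus (k : R) : R := (1 - compl_modulus k) / (1 + compl_modulus k).

Lemma dn_sq_compl (k u : R) : 0 < k < 1 ->
  dn k u ^ 2 = 1 - (1 - compl_modulus k ^ 2) * sn k u ^ 2.
Proof. intros hk. rewrite dn_sq, compl_modulus_sq by assumption. ring. Qed.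

Lemma landen_dn_pos (k u : R) : 0 < k < 1 -> 0 < landen_dn k u.
Proof.
  intros hk. pose proof (compl_modulus_bounds k hk). pose proof (dn_pos k u hk).
  unfold landen_dn. apply Rdiv_lt_0_compat; [ | lra].
  apply Rplus_lt_0_compat; [assumption | ]. apply Rdiv_lt_0_compat; lra.
Qed.

Lemma landen_sn2_cn2 (k u : R) : 0 < k < 1 -> landen_sn k u ^ 2 + landen_cn k u ^ 2 = 1.
Proof.
  intros hk. pose proof (compl_modulus_bounds k hk). pose proof (dn_pos k u hk).
  pose proof (dn_sq_compl k u hk) as H1. pose proof (sn2_cn2 k u) as H2.
  unfold landen_sn, landen_cn. field_simplify_eq; [ | lra].
  replace (dn k u ^ 4) with ((dn k u ^ 2) ^ 2) by ring. rewrite H1, H2. ring.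
Qed.

Lemma landen_dn_sq (k u : R) : 0 < k < 1 ->
  landen_dn k u ^ 2 = 1 - landen_modulus k ^ 2 * landen_sn k u ^ 2.
Proof.
  intros hk. pose proof (compl_modulus_bounds k hk). pose proof (dn_pos k u hk).
  pose proof (dn_sq_compl k u hk) as H1. pose proof (sn2_cn2 k u) as H2.
  unfold landen_sn, landen_dn, landen_modulus. field_simplify_eq; [ | lra].
  replace (dn k u ^ 4) with ((dn k u ^ 2) ^ 2) by ring. rewrite H1, H2. ring.
Qed.

(** With the companion for the sum, this is what turns sn/(dn + cn) of the Landen modulus into a
    multiple of sn/cn of modulus [k]. *)
Lemma landen_dn_minus_cn (k u : R) : 0 < k < 1 ->
  (landen_dn k u - landen_cn k u) * dn k u = 2 * compl_modulus k * sn k u ^ 2.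
Proof.
  intros hk. pose proof (compl_modulus_bounds k hk). pose proof (dn_pos k u hk).
  pose proof (dn_sq_compl k u hk) as H1.
  unfold landen_dn, landen_cn. field_simplify_eq; [ | lra].
  rewrite H1. ring.
Qed.

Lemma landen_dn_plus_cn (k u : R) : 0 < k < 1 ->
  (landen_dn k u + landen_cn k u) * dn k u = 2 * cn k u ^ 2.
Proof.
  intros hk. pose proof (compl_modulus_bounds k hk). pose proof (dn_pos k u hk).
  pose proof (dn_sq_compl k u hk) as H1. pose proof (sn2_cn2 k u) as H2.
  unfold landen_dn, landen_cn. field_simplify_eq; [ | lra].
  rewrite H1, H2. ring.
Qed.

(** * The reflection u |-> K/2 - u *)

Section Reflection.

Context (k u : R) (hk : 0 < k < 1).
(** This is dn(K/2); replacing k' by r^2 makes the identities below rational in r. *)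
Let r := sqrt (compl_modulus k).
Let den := 1 - (1 - r ^ 2) * sn k u ^ 2.

Lemma sqrt_compl_bounds : 0 < r < 1 /\ r ^ 2 = compl_modulus k.
Proof.
  pose proof (compl_modulus_bounds k hk). unfold r.
  rewrite pow2_sqrt by lra. repeat split.
  - apply sqrt_lt_R0; lra.
  - rewrite <- sqrt_1. apply sqrt_lt_1_alt. lra.
Qed.

Lemma half_K_sub_denom_pos : 0 < den.
Proof.
  destruct sqrt_compl_bounds. pose proof (sn_sq_le_1 k u). unfold den. nra.
Qed.

Lemma half_K_dn : dn k (ellK k / 2) = r.
Proof.
  destruct (half_K k hk) as (HS & HC & HD & HS2 & HC2 & HD2 & HCSD).
  unfold r. rewrite <- HD2, sqrt_pow2; lra.
Qed.

(** By [half_K], k^2 sn(K/2)^2 = (1 - k'^2)/(1 + k') = 1 - k'. *)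
Lemma half_K_sub_denom : 1 - k ^ 2 * sn k (ellK k / 2) ^ 2 * sn k u ^ 2 = den.
Proof.
  destruct (half_K k hk) as (HS & HC & HD & HS2 & HC2 & HD2 & HCSD).
  destruct sqrt_compl_bounds as [Hr Hr2].
  pose proof (compl_modulus_sq k hk).
  unfold den. rewrite HS2. replace (k ^ 2) with (1 - compl_modulus k ^ 2) by lra.
  rewrite <- Hr2. field. nra.
Qed.

Lemma dn_half_K_sub : dn k (ellK k / 2 - u) = r * (dn k u + (1 - r ^ 2) * sn k u * cn k u) / den.
Proof.
  rewrite dn_sub, half_K_sub_denom, half_K_dn by assumption.
  destruct (half_K k hk) as (HS & HC & HD & HS2 & HC2 & HD2 & HCSD).
  destruct sqrt_compl_bounds as [Hr Hr2].
  pose proof (compl_modulus_sq k hk) as Hk2.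
  f_equal. rewrite HCSD, half_K_dn.
  replace (k ^ 2 * sn k (ellK k / 2) * (sn k (ellK k / 2) * r) * sn k u * cn k u)
    with ((k ^ 2 * sn k (ellK k / 2) ^ 2) * r * sn k u * cn k u) by ring.
  replace (k ^ 2 * sn k (ellK k / 2) ^ 2) with (1 - r ^ 2); [ring | ].
  rewrite HS2. replace (k ^ 2) with (1 - compl_modulus k ^ 2) by lra.
  rewrite <- Hr2. field. nra.
Qed.

Lemma sn_cn_half_K_sub :
  sn k (ellK k / 2 - u) * cn k (ellK k / 2 - u) =
  r * (cn k u * dn k u - r ^ 2 * sn k u) * (cn k u + sn k u * dn k u) / (1 + r ^ 2) / den ^ 2.
Proof.
  rewrite sn_sub, cn_sub, half_K_sub_denom, half_K_dn by assumption.
  destruct (half_K k hk) as (HS & HC & HD & HS2 & HC2 & HD2 & HCSD).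
  destruct sqrt_compl_bounds as [Hr Hr2]. pose proof half_K_sub_denom_pos.
  rewrite HCSD, half_K_dn.
  replace (_ * _) with (sn k (ellK k / 2) ^ 2 * (r * (cn k u * dn k u - r ^ 2 * sn k u) *
    (cn k u + sn k u * dn k u)) / den ^ 2) by (field; lra).
  rewrite HS2, <- Hr2. field. nra.
Qed.

(** For the Landen modulus m this is dn(K_m - U) dn U = m', where m' = 2 sqrt(k')/(1 + k') is the
    complementary modulus. *)
Lemma landen_dn_half_K_sub :
  landen_dn k (ellK k / 2 - u) * landen_dn k u = 2 * r / (1 + compl_modulus k).
Proof.
  destruct sqrt_compl_bounds as [Hr Hr2]. pose proof half_K_sub_denom_pos as Hden.
  pose proof (dn_pos k u hk). pose proof (dn_pos k (ellK k / 2 - u) hk).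
  pose proof (dn_sq_compl k u hk) as H1. pose proof (sn2_cn2 k u) as H2.
  unfold landen_dn. rewrite dn_half_K_sub in *. rewrite <- Hr2 in *.
  (* Up to a positive factor this is dn(K/2 - u); as a denominator it has to be nonzero. *)
  assert (0 < dn k u + (1 - r ^ 2) * sn k u * cn k u).
  { apply Rmult_lt_reg_l with (r / den); [apply Rdiv_lt_0_compat; lra | ].
    rewrite Rmult_0_r. eapply Rlt_le_trans; [apply H0 | right; field; lra]. }
  assert (1 + r ^ 2 <> 0) by nra. unfold den in *.
  field_simplify_eq; [ring [H1 H2] | lra].
Qed.

(** The Landen form of sn(K_m - U) = cn U/dn U. *)
Lemma landen_sn_half_K_sub : landen_sn k (ellK k / 2 - u) * landen_dn k u = landen_cn k u.
Proof.
  destruct sqrt_compl_bounds as [Hr Hr2]. pose proof half_K_sub_denom_pos as Hden.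
  pose proof (dn_pos k u hk). pose proof (dn_pos k (ellK k / 2 - u) hk).
  pose proof (dn_sq_compl k u hk) as H1. pose proof (sn2_cn2 k u) as H2.
  unfold landen_dn, landen_sn, landen_cn. rewrite (Rmult_assoc _ (sn _ _)), sn_cn_half_K_sub.
  rewrite dn_half_K_sub in *. rewrite <- Hr2 in *.
  assert (0 < dn k u + (1 - r ^ 2) * sn k u * cn k u).
  { apply Rmult_lt_reg_l with (r / den); [apply Rdiv_lt_0_compat; lra | ].
    rewrite Rmult_0_r. eapply Rlt_le_trans; [apply H0 | right; field; lra]. }
  assert (1 + r ^ 2 <> 0) by nra. assert (1 - r ^ 2 <> 0) by nra. unfold den in *.
  field_simplify_eq; [ring [H1 H2] | repeat split; lra].
Qed.

End Reflection.

Lemma half_K_sub_involutive (k u : R) : ellK k / 2 - (ellK k / 2 - u) = u.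
Proof. ring. Qed.

Lemma dn_half_K_even (k u : R) : 0 < k < 1 ->
  dn k (u - ellK k / 2) = dn k (ellK k / 2 - u).
Proof. intros hk. rewrite <- dn_opp by assumption. f_equal. ring. Qed.

Lemma cn_half_K_even (k u : R) : 0 < k < 1 ->
  cn k (u - ellK k / 2) = cn k (ellK k / 2 - u).
Proof. intros hk. rewrite <- cn_opp by assumption. f_equal. ring. Qed.

Lemma sn_half_K_odd (k u : R) : 0 < k < 1 ->
  sn k (u - ellK k / 2) = - sn k (ellK k / 2 - u).
Proof. intros hk. rewrite <- sn_opp by assumption. f_equal. ring. Qed.

(** This is what later yields every position with every choice of the variable signs. The equation
    [landen_cn k u = x] is quadratic in dn u; its positive root lies in [k', 1] and determines sn^2
    u, after which the sign of sn u is free to match that of y. *)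
Lemma landen_surj (k x y : R) : 0 < k < 1 -> x ^ 2 + y ^ 2 = 1 ->
  exists u, landen_cn k u = x /\ landen_sn k u = y.
Proof.
  intros hk Hxy. pose proof (compl_modulus_bounds k hk) as hk'.
  pose proof (compl_modulus_sq k hk) as hk2. set (k' := compl_modulus k) in *.
  set (D := ((1 - k') * x + sqrt (((1 - k') * x) ^ 2 + 4 * k')) / 2).
  assert (Hq : D ^ 2 - (1 - k') * x * D - k' = 0).
  { unfold D. set (z := (1 - k') * x).
    assert (Hs : sqrt (z ^ 2 + 4 * k') ^ 2 = z ^ 2 + 4 * k') by (apply pow2_sqrt; nra).
    replace (((z + sqrt (z ^ 2 + 4 * k')) / 2) ^ 2) with
      ((z ^ 2 + 2 * z * sqrt (z ^ 2 + 4 * k') + sqrt (z ^ 2 + 4 * k') ^ 2) / 4) by field.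
    rewrite Hs. field. }
  assert (HD0 : 0 < D).
  { unfold D. set (z := (1 - k') * x).
    assert (Rabs z < sqrt (z ^ 2 + 4 * k')).
    { rewrite <- sqrt_pow2 with (x := Rabs z) by apply Rabs_pos.
      apply sqrt_lt_1_alt. rewrite <- (pow2_abs z). pose proof (pow2_ge_0 (Rabs z)). lra. }
    assert (- z <= Rabs z) by (rewrite <- Rabs_Ropp; apply Rle_abs). lra. }
  clearbody D.   assert (hx : -1 <= x <= 1) by nra.
  (* The quadratic in [Hq] equals (D - k')(D + 1) - (1 - k')(1 + x)D and also (D - 1)(D + k') + (1 -
     k')(1 - x)D; each form gives one bound. *)
  assert (HD1 : k' <= D <= 1).
  { split.
    - apply Rnot_lt_le. intros h.
      assert (0 < (k' - D) * (1 + D)) by (apply Rmult_lt_0_compat; lra).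
      assert ((1 - k') * (1 + x) * D >= 0).
      { apply Rle_ge. repeat apply Rmult_le_pos; lra. }
      nra.
    - apply Rnot_lt_le. intros h.
      assert (0 < (D - 1) * (D + k')) by (apply Rmult_lt_0_compat; lra).
      assert (0 <= (1 - k') * (1 - x) * D) by (repeat apply Rmult_le_pos; lra).
      nra. }
  set (t := (1 - D ^ 2) / (1 - k' ^ 2)).
  assert (Ht : t * (1 - k' ^ 2) = 1 - D ^ 2) by (unfold t; field; nra).
  assert (Ht1 : 0 <= t <= 1).
  { split.
    - unfold t. apply Rdiv_le_0_compat; nra.
    - apply Rmult_le_reg_r with (1 - k' ^ 2); nra. }
  assert (exists s, s ^ 2 = t /\ 0 <= s * y) as [s [Hs2 Hsy]].
  { pose proof (sqrt_pos t). destruct (Rle_or_lt 0 y).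
    - exists (sqrt t). split; [apply pow2_sqrt; lra | nra].
    - exists (- sqrt t). split; [rewrite <- (pow2_sqrt t) at 2 by lra; ring | nra]. }
  assert (hs : -1 <= s <= 1) by nra.
  (* The amplitude [asin s] lies in [-PI/2, PI/2], so cn is nonnegative there and [landen_sn] cannot
     have the sign opposite to s. *)
  exists (ellF k (asin s)).
  assert (Hsn : sn k (ellF k (asin s)) = s)
    by (unfold sn; rewrite am_ellF by assumption; now apply sin_asin).
  assert (Hcn : 0 <= cn k (ellF k (asin s))).
  { unfold cn. rewrite am_ellF, cos_asin by assumption. apply sqrt_pos. }
  assert (Hdn : dn k (ellF k (asin s)) = D).
  { unfold dn. rewrite Hsn, Hs2. rewrite <- (sqrt_pow2 D) by lra. f_equal. nra. }
  assert (Hc : landen_cn k (ellF k (asin s)) = x).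
  { unfold landen_cn. fold k'. rewrite Hdn. field_simplify_eq; [nra | lra]. }
  split; [exact Hc | ].
  pose proof (landen_sn2_cn2 k (ellF k (asin s)) hk) as H1. rewrite Hc in H1.
  assert (Hpos : 0 <= landen_sn k (ellF k (asin s)) * y).
  { unfold landen_sn. fold k'. rewrite Hdn, Hsn.
    replace (_ * y) with ((1 + k') * (s * y) * cn k (ellF k (asin s)) / D) by (field; lra).
    apply Rdiv_le_0_compat; [ | lra]. apply Rmult_le_pos; [apply Rmult_le_pos | ]; lra. }
  assert (H2 : (landen_sn k (ellF k (asin s)) - y) * (landen_sn k (ellF k (asin s)) + y) = 0)
    by nra.
  apply Rmult_integral in H2. destruct H2; nra.
Qed.

(** * Dihedral angles *)

Lemma polar (x y : R) : x ^ 2 + y ^ 2 = 1 -> exists a, cos a = x /\ sin a = y.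
Proof.
  intros H. assert (hx : -1 <= x <= 1) by nra.
  assert (Hy : sqrt (1 - x²) = Rabs y).
  { rewrite <- sqrt_Rsqr_abs. f_equal. unfold Rsqr. lra. }
  destruct (Rle_or_lt 0 y) as [h | h].
  - exists (acos x). rewrite cos_acos, sin_acos, Hy by assumption.
    now rewrite Rabs_pos_eq.
  - exists (- acos x). rewrite cos_neg, sin_neg, cos_acos, sin_acos, Hy by assumption.
    rewrite Rabs_left by assumption. lra.
Qed.

Definition lin2 (a b : R) (e f : vec4) : vec4 := vadd (vscale a e) (vscale b f).

Ltac vec4_ext := repeat match goal with |- (_, _) = (_, _) => apply f_equal2 end.

Lemma dot_lin2_r (a b : R) (e f x : vec4) : dot (lin2 a b e f) x = a * dot e x + b * dot f x.
Proof. destruct e as [[[? ?] ?] ?], f as [[[? ?] ?] ?], x as [[[? ?] ?] ?]. simpl. ring. Qed.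

Lemma dot_comm (x y : vec4) : dot x y = dot y x.
Proof. destruct x as [[[? ?] ?] ?], y as [[[? ?] ?] ?]. simpl. ring. Qed.

(** Components along u and v drop out, so orientation questions reduce to a two-by-two determinant
    in the normal plane of the edge. *)
Lemma det4_lin2 (u v e f : vec4) (a b c d x y z : R) :
  det4 u (lin2 a b e f) v (vadd (vscale x u) (vadd (vscale y v) (vscale z (lin2 c d e f)))) =
  z * (a * d - b * c) * det4 u e v f.
Proof.
  destruct u as [[[? ?] ?] ?], v as [[[? ?] ?] ?], e as [[[? ?] ?] ?], f as [[[? ?] ?] ?].
  unfold det4, lin2, det3; simpl. ring.
Qed.

(* [(a1, b1)] and [(a2, b2)] are the directions of the two faces in the positively or
   negatively oriented frame [(e, f)] of the normal plane; the two relations with [X] and [Y]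
   say that [a2 + i b2 = (a1 + i b1) (X + i Y) / (X - i Y)]. *)
Lemma dihedral_angle_frame (sg eta : R) (u v e f w1 w2 : vec4)
    (x1 y1 z1 a1 b1 x2 y2 z2 a2 b2 X Y : R) :
  is_sign sg -> is_sign eta ->
  dot e e = 1 -> dot f f = 1 -> dot e f = 0 ->
  dot e u = 0 -> dot e v = 0 -> dot f u = 0 -> dot f v = 0 ->
  0 < eta * det4 u e v f ->
  w1 = vadd (vscale x1 u) (vadd (vscale y1 v) (vscale z1 (lin2 a1 b1 e f))) ->
  w2 = vadd (vscale x2 u) (vadd (vscale y2 v) (vscale z2 (lin2 a2 b2 e f))) ->
  0 < z1 -> 0 < z2 -> 0 < a1 ^ 2 + b1 ^ 2 -> 0 < X ^ 2 + Y ^ 2 ->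
  X * (a2 - a1) = - Y * (b1 + b2) -> X * (b2 - b1) = Y * (a1 + a2) ->
  exists phi, oriented_dihedral_angle sg u v w1 w2 phi /\
    half_tan phi = Pdiv (sg * eta * Y) X.
Proof.
  intros Hsg Heta Hee Hff Hef Heu Hev Hfu Hfv Hdet Hw1 Hw2 Hz1 Hz2 HN HXY HX HY.
  set (N := sqrt (a1 ^ 2 + b1 ^ 2)). assert (HN0 : 0 < N) by now apply sqrt_lt_R0.
  assert (HN2 : N ^ 2 = a1 ^ 2 + b1 ^ 2) by (apply pow2_sqrt; lra).
  set (rho := sqrt (X ^ 2 + Y ^ 2)). assert (Hrho0 : 0 < rho) by now apply sqrt_lt_R0.
  assert (Hrho2 : rho ^ 2 = X ^ 2 + Y ^ 2) by (apply pow2_sqrt; lra).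
  assert (Hsg2 : sg ^ 2 = 1) by (destruct Hsg; subst; ring).
  assert (Heta2 : eta ^ 2 = 1) by (destruct Heta; subst; ring).
  (* [al] is half of the dihedral angle. The sign [sg * eta] tells whether the prescribed rotation
     from m_1 to n_1 runs with or against the frame (e, f). *)
  destruct (polar (X / rho) (sg * eta * Y / rho)) as [al [Hc Hs]].
  { field_simplify_eq; [ | lra]. rewrite Hrho2. ring [Hsg2 Heta2]. }
  (* The relations [HX] and [HY] are linear in (a2, b2) with determinant X^2 + Y^2; the solution is
     multiplication by the square of (X + iY)/rho. *)
  assert (Ha2 : a2 = (a1 * (X ^ 2 - Y ^ 2) - b1 * (2 * X * Y)) / rho ^ 2).
  { rewrite Hrho2. field_simplify_eq; [ | lra].
    assert (X * (X * (a2 - a1)) = X * (- Y * (b1 + b2))) by now rewrite HX.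
    assert (Y * (X * (b2 - b1)) = Y * (Y * (a1 + a2))) by now rewrite HY.
    nra. }
  assert (Hb2 : b2 = (b1 * (X ^ 2 - Y ^ 2) + a1 * (2 * X * Y)) / rho ^ 2).
  { rewrite Hrho2. field_simplify_eq; [ | lra].
    assert (Y * (X * (a2 - a1)) = Y * (- Y * (b1 + b2))) by now rewrite HX.
    assert (X * (X * (b2 - b1)) = X * (Y * (a1 + a2))) by now rewrite HY.
    nra. }
  assert (Hn2 : a2 ^ 2 + b2 ^ 2 = N ^ 2).
  { rewrite Ha2, Hb2, HN2. field_simplify_eq; [ | lra].
    replace (rho ^ 4) with ((rho ^ 2) ^ 2) by ring. rewrite Hrho2. ring. }
  exists (2 * al). split.
  (* The normal m_1 is n_1 turned through a right angle, backward or forward in the frame according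
     to [sg * eta]; this choice makes the signed determinant positive. *)
  - exists (lin2 (sg * eta * b1 / N) (- (sg * eta * a1 / N)) e f),
      (lin2 (a1 / N) (b1 / N) e f), (lin2 (a2 / N) (b2 / N) e f).
    assert (Hunit : forall a b, a ^ 2 + b ^ 2 = 1 -> dot (lin2 a b e f) (lin2 a b e f) = 1).
    { intros a b Hab. rewrite dot_lin2_r, !(dot_comm _ (lin2 a b e f)), !dot_lin2_r.
      rewrite Hee, Hff, (dot_comm f e), Hef. lra. }
    assert (Hperp : forall a b, dot (lin2 a b e f) u = 0 /\ dot (lin2 a b e f) v = 0).
    { intros a b. rewrite !dot_lin2_r, Heu, Hev, Hfu, Hfv. lra. }
    repeat apply conj; try apply Hperp.
    + apply Hunit. field_simplify_eq; [ | lra]. rewrite HN2. ring [Hsg2 Heta2].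
    + rewrite dot_comm, Hw1.
      transitivity (x1 * dot (lin2 (sg * eta * b1 / N) (- (sg * eta * a1 / N)) e f) u
        + y1 * dot (lin2 (sg * eta * b1 / N) (- (sg * eta * a1 / N)) e f) v
        + z1 * dot (lin2 (sg * eta * b1 / N) (- (sg * eta * a1 / N)) e f) (lin2 a1 b1 e f)).
      { generalize (lin2 (sg * eta * b1 / N) (- (sg * eta * a1 / N)) e f) (lin2 a1 b1 e f).
        clear. intros [[[? ?] ?] ?] [[[? ?] ?] ?].
        destruct u as [[[? ?] ?] ?], v as [[[? ?] ?] ?]. simpl. ring. }
      rewrite (proj1 (Hperp _ _)), (proj2 (Hperp _ _)).
      rewrite dot_lin2_r, !(dot_comm _ (lin2 a1 b1 e f)), !dot_lin2_r.
      rewrite Hee, Hff, (dot_comm f e), Hef. field. lra.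
    + rewrite Hw1, det4_lin2.
      replace (sg * _) with (z1 / N * (sg ^ 2 * (a1 ^ 2 + b1 ^ 2)) * (eta * det4 u e v f))
        by (field; lra).
      rewrite Hsg2. apply Rmult_lt_0_compat; [ | assumption].
      apply Rmult_lt_0_compat; [now apply Rdiv_lt_0_compat | lra].
    + apply Hunit. field_simplify_eq; lra.
    + exists (- x1 / (z1 * N)), (- y1 / (z1 * N)), (1 / (z1 * N)).
      assert (0 < z1 * N) by now apply Rmult_lt_0_compat.
      split; [apply Rdiv_lt_0_compat; lra | ].
      rewrite Hw1. clear - Hz1 HN0.
      destruct u as [[[? ?] ?] ?], v as [[[? ?] ?] ?], e as [[[? ?] ?] ?], f as [[[? ?] ?] ?].
      unfold lin2; simpl. vec4_ext; field; lra.
    + apply Hunit. field_simplify_eq; lra.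
    + exists (- x2 / (z2 * N)), (- y2 / (z2 * N)), (1 / (z2 * N)).
      assert (0 < z2 * N) by now apply Rmult_lt_0_compat.
      split; [apply Rdiv_lt_0_compat; lra | ].
      rewrite Hw2. clear - Hz2 HN0.
      destruct u as [[[? ?] ?] ?], v as [[[? ?] ?] ?], e as [[[? ?] ?] ?], f as [[[? ?] ?] ?].
      unfold lin2; simpl. vec4_ext; field; lra.
    + rewrite cos_2a, sin_2a, Hc, Hs.
      assert (Ea : a2 / N = (X / rho * (X / rho) - sg * eta * Y / rho * (sg * eta * Y / rho)) *
        (a1 / N) - 2 * (sg * eta * Y / rho) * (X / rho) * (sg * eta * b1 / N)).
      { rewrite Ha2. field_simplify_eq; [ | lra]. ring [Hsg2 Heta2]. }
      assert (Eb : b2 / N = (X / rho * (X / rho) - sg * eta * Y / rho * (sg * eta * Y / rho)) *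
        (b1 / N) + 2 * (sg * eta * Y / rho) * (X / rho) * (sg * eta * a1 / N)).
      { rewrite Hb2. field_simplify_eq; [ | lra]. ring [Hsg2 Heta2]. }
      rewrite Ea, Eb. clear.
      destruct e as [[[? ?] ?] ?], f as [[[? ?] ?] ?]. unfold lin2; simpl.
      vec4_ext; ring.
  - unfold half_tan, Pdiv. replace (2 * al / 2) with al by field.
    destruct (Req_EM_T (cos al) 0) as [h | h], (Req_EM_T X 0) as [h' | h']; auto.
    + exfalso. apply h'. rewrite Hc in h. replace X with (X / rho * rho) by (field; lra).
      rewrite h. ring.
    + exfalso. apply h. rewrite Hc, h'. field. lra.
    + f_equal. unfold tan. rewrite Hc, Hs. field. lra.
Qed.

(** * Half-angle tangents of a position *)

Definition sel {T : Type} (sd : side) (x y : T) : T := match sd with sa => x | sb => y end.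

(** Heights replace theta and the signs: the signed square roots of [octa] become variables subject
    to f_i^2 = c^2 - p_i^2 and g_i^2 = s^2 - q_i^2, so what follows is algebra. *)
Definition position (p1 p2 q1 q2 c s f1 f2 g1 g2 : R) : octahedron :=
  fun i sd =>
    match i with
    | i1 => sel sd (p1 / c, f1 / c, 0, 0) (p2 / c, f2 / c, 0, 0)
    | i2 => sel sd (0, 0, q1 / s, g1 / s) (0, 0, q2 / s, g2 / s)
    | i3 => sel sd (c, 0, s, 0) (c, 0, - s, 0)
    end.

(* [[X : Y]] is the half angle between the projections of [a_1] and [b_1] to the normal plane of
   an edge [u_2 u_3]. *)
Definition half_angle (p1 p2 f1 f2 q g X Y : R) : Prop :=
  let r := sqrt (1 - q ^ 2) in
  let r1 := sqrt (1 - q ^ 2 - p1 ^ 2) in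
  let r2 := sqrt (1 - q ^ 2 - p2 ^ 2) in
  X * (f2 * r / r2 - f1 * r / r1) = - Y * (p1 * g / r1 + p2 * g / r2) /\
  X * (p2 * g / r2 - p1 * g / r1) = Y * (f1 * r / r1 + f2 * r / r2).

(** Changing the sign of both f_i, or of g, reflects the normal plane, and each reflection reverses
    the angle. *)
Lemma half_angle_signs (d e p1 p2 f1 f2 q g X Y : R) :
  is_sign d -> is_sign e -> half_angle p1 p2 f1 f2 q g X Y ->
  half_angle p1 p2 (d * f1) (d * f2) q (e * g) X (d * e * Y).
Proof.
  intros [-> | ->] [-> | ->] [H1 H2]; split; cbv zeta; unfold Rdiv in *; lra.
Qed.

Lemma side_sign_is_sign (sd : side) : is_sign (side_sign sd).
Proof. destruct sd; [left | right]; reflexivity. Qed.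

Lemma is_sign_mul (d e : R) : is_sign d -> is_sign e -> is_sign (d * e).
Proof. intros [-> | ->] [-> | ->]; unfold is_sign; lra. Qed.

Lemma is_sign_opp (d : R) : is_sign d -> is_sign (- d).
Proof. intros [-> | ->]; unfold is_sign; lra. Qed.

Lemma is_sign_sq (d : R) : is_sign d -> d ^ 2 = 1.
Proof. intros [-> | ->]; ring. Qed.

Section Edges.

Context (p1 p2 q1 q2 c s f1 f2 g1 g2 : R) (F : face).
Context (hc : 0 < c) (hs : 0 < s) (hcs : c ^ 2 + s ^ 2 = 1).
Context (hf1 : f1 ^ 2 = c ^ 2 - p1 ^ 2) (hf2 : f2 ^ 2 = c ^ 2 - p2 ^ 2).
Context (hg1 : g1 ^ 2 = s ^ 2 - q1 ^ 2) (hg2 : g2 ^ 2 = s ^ 2 - q2 ^ 2).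
Context (h11 : p1 ^ 2 + q1 ^ 2 < 1) (h12 : p1 ^ 2 + q2 ^ 2 < 1).
Context (h21 : p2 ^ 2 + q1 ^ 2 < 1) (h22 : p2 ^ 2 + q2 ^ 2 < 1).

Let P := position p1 p2 q1 q2 c s f1 f2 g1 g2.

(** Passing from a_3 to b_3 reverses both the sign of the oriented face and the orientation of the
    chosen frame, so only the side of u_2 remains in the result. The denominators in [half_angle]
    give the two directions the common length c. *)
Lemma edge_t_1 (X Y : R) : 0 < X ^ 2 + Y ^ 2 ->
  half_angle p1 p2 f1 f2 (sel (F i2) q1 q2) (sel (F i2) g1 g2) X Y ->
  edge_t P F i1 (Pdiv (- side_sign (F i2) * Y) X).
Proof.
  intros HXY.
  set (q := sel (F i2) q1 q2). set (g := sel (F i2) g1 g2).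
  assert (hg : g ^ 2 = s ^ 2 - q ^ 2) by (unfold g, q; now destruct (F i2)).
  assert (h1 : 0 < 1 - q ^ 2 - p1 ^ 2) by (unfold q; destruct (F i2); simpl sel; lra).
  assert (h2 : 0 < 1 - q ^ 2 - p2 ^ 2) by (unfold q; destruct (F i2); simpl sel; lra).
  assert (h0 : 0 < 1 - q ^ 2) by (pose proof (pow2_ge_0 p1); lra).
  intros [HX HY]. cbv zeta in HX, HY.
  assert (hr := sqrt_lt_R0 _ h0). assert (hr2 := pow2_sqrt _ (Rlt_le _ _ h0)).
  assert (hr1 := sqrt_lt_R0 _ h1). assert (hr12 := pow2_sqrt _ (Rlt_le _ _ h1)).
  assert (hr' := sqrt_lt_R0 _ h2). assert (hr22 := pow2_sqrt _ (Rlt_le _ _ h2)).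
  set (r := sqrt (1 - q ^ 2)) in *. set (r1 := sqrt (1 - q ^ 2 - p1 ^ 2)) in *.
  set (r2 := sqrt (1 - q ^ 2 - p2 ^ 2)) in *.
  set (sg := side_sign (F i3)).
  assert (Hsg : is_sign sg) by apply side_sign_is_sign.
  assert (Hsg2 := is_sign_sq _ Hsg).
  assert (Hu : P i2 (F i2) = (0, 0, q / s, g / s)) by (unfold q, g; now destruct (F i2)).
  assert (Hv : P i3 (F i3) = (c, 0, sg * s, 0)).
  { unfold sg. destruct (F i3); simpl; vec4_ext; ring. }
  (* A vertex a_1 or b_1 is split along the two edge vertices and the frame of the normal plane. *)
  assert (Hframe : forall p f rp, 0 < rp -> f ^ 2 = c ^ 2 - p ^ 2 ->
    (p / c, f / c, 0, 0) =
    vadd (vscale (- sg * q * p / (1 - q ^ 2)) (0, 0, q / s, g / s))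
      (vadd (vscale (p / (1 - q ^ 2)) (c, 0, sg * s, 0))
        (vscale (rp / (c * r)) (lin2 (f * r / rp) (p * g / rp) (0, 1, 0, 0)
          (g / r, 0, - sg * c * g / (s * r), sg * c * q / (s * r)))))).
  { intros p f rp Hrp Hf. rewrite <- hr2. unfold lin2; simpl. vec4_ext.
    - field_simplify_eq; [ | lra]. replace (g ^ 2) with (1 - c ^ 2 - q ^ 2) by lra.
      replace (r ^ 2) with (1 - q ^ 2) by lra. ring.
    - field. lra.
    - field_simplify_eq; [ | lra]. replace (g ^ 2) with (s ^ 2 - q ^ 2) by lra. ring.
    - field. lra. }
  destruct (dihedral_angle_frame (side_sign (F i2) * sg) (- sg) (P i2 (F i2)) (P i3 (F i3))
    (0, 1, 0, 0) (g / r, 0, - sg * c * g / (s * r), sg * c * q / (s * r)) (P i1 sa) (P i1 sb)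
    (- sg * q * p1 / (1 - q ^ 2)) (p1 / (1 - q ^ 2)) (r1 / (c * r)) (f1 * r / r1) (p1 * g / r1)
    (- sg * q * p2 / (1 - q ^ 2)) (p2 / (1 - q ^ 2)) (r2 / (c * r)) (f2 * r / r2) (p2 * g / r2)
    X Y) as [phi [Hphi Ht]]; rewrite ?Hu, ?Hv; auto using is_sign_mul, is_sign_opp,
    side_sign_is_sign.
  all: clear HX HY HXY Hu Hv.
  - simpl; ring.
  - simpl. field_simplify_eq; [ | lra]. replace (g ^ 2) with (s ^ 2 - q ^ 2) by lra.
    rewrite Hsg2, hr2. replace (c ^ 2) with (1 - s ^ 2) by lra. ring.
  - simpl. ring.
  - simpl. ring.
  - simpl. ring.
  - simpl. field. lra.
  - simpl. field_simplify_eq; [ | lra]. ring [Hsg2].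
  - unfold det4, det3.
    replace (- sg * _) with (sg ^ 2 * r).
    { rewrite Hsg2. lra. }
    field_simplify_eq; [ | lra]. replace (c ^ 2) with (1 - s ^ 2) by lra.
    replace (r ^ 2) with (1 - q ^ 2) by lra.
    replace (s ^ 2) with (g ^ 2 + q ^ 2) by lra. ring [Hsg2].
  - now apply Hframe.
  - now apply Hframe.
  - apply Rdiv_lt_0_compat; [lra | now apply Rmult_lt_0_compat].
  - apply Rdiv_lt_0_compat; [lra | now apply Rmult_lt_0_compat].
  - replace (_ + _) with (c ^ 2); [now apply pow_lt | ].
    field_simplify_eq; [ | lra]. rewrite hf1, hr2, hr12.
    replace (g ^ 2) with (1 - c ^ 2 - q ^ 2) by lra. ring.
  - exists phi. split; [exact Hphi | ]. simpl next. rewrite Ht. f_equal.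
    ring_simplify. rewrite Hsg2. ring.
Qed.

(** The computation of [edge_t_1] with the indices 1 and 2 exchanged. The frame is now positive for
    both sides of u_3, so the side of u_3 stays in the sign. *)
Lemma edge_t_2 (X Y : R) : 0 < X ^ 2 + Y ^ 2 ->
  half_angle q1 q2 g1 g2 (sel (F i1) p1 p2) (sel (F i1) f1 f2) X Y ->
  edge_t P F i2 (Pdiv (side_sign (F i3) * side_sign (F i1) * Y) X).
Proof.
  intros HXY.
  set (p := sel (F i1) p1 p2). set (f := sel (F i1) f1 f2).
  assert (hf : f ^ 2 = c ^ 2 - p ^ 2) by (unfold f, p; now destruct (F i1)).
  assert (h1 : 0 < 1 - p ^ 2 - q1 ^ 2) by (unfold p; destruct (F i1); simpl sel; lra).
  assert (h2 : 0 < 1 - p ^ 2 - q2 ^ 2) by (unfold p; destruct (F i1); simpl sel; lra).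
  assert (h0 : 0 < 1 - p ^ 2) by (pose proof (pow2_ge_0 q1); lra).
  intros [HX HY]. cbv zeta in HX, HY.
  assert (hr := sqrt_lt_R0 _ h0). assert (hr2 := pow2_sqrt _ (Rlt_le _ _ h0)).
  assert (hr1 := sqrt_lt_R0 _ h1). assert (hr12 := pow2_sqrt _ (Rlt_le _ _ h1)).
  assert (hr' := sqrt_lt_R0 _ h2). assert (hr22 := pow2_sqrt _ (Rlt_le _ _ h2)).
  set (r := sqrt (1 - p ^ 2)) in *. set (r1 := sqrt (1 - p ^ 2 - q1 ^ 2)) in *.
  set (r2 := sqrt (1 - p ^ 2 - q2 ^ 2)) in *.
  set (sg := side_sign (F i3)).
  assert (Hsg : is_sign sg) by apply side_sign_is_sign.
  assert (Hsg2 := is_sign_sq _ Hsg).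
  assert (Hu : P i3 (F i3) = (c, 0, sg * s, 0)).
  { unfold sg. destruct (F i3); simpl; vec4_ext; ring. }
  assert (Hv : P i1 (F i1) = (p / c, f / c, 0, 0)) by (unfold p, f; now destruct (F i1)).
  assert (Hframe : forall q g rq, 0 < rq -> g ^ 2 = s ^ 2 - q ^ 2 ->
    (0, 0, q / s, g / s) =
    vadd (vscale (sg * q / (1 - p ^ 2)) (c, 0, sg * s, 0))
      (vadd (vscale (- sg * p * q / (1 - p ^ 2)) (p / c, f / c, 0, 0))
        (vscale (rq / (s * r)) (lin2 (g * r / rq) (q * f / rq) (0, 0, 0, 1)
          (- sg * s * f / (c * r), sg * s * p / (c * r), f / r, 0))))).
  { intros q g rq Hrq Hg. rewrite <- hr2. unfold lin2; simpl. vec4_ext.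
    - field_simplify_eq; [ | lra]. replace (f ^ 2) with (c ^ 2 - p ^ 2) by lra. ring.
    - field. lra.
    - field_simplify_eq; [ | lra]. replace (f ^ 2) with (c ^ 2 - p ^ 2) by lra.
      rewrite Hsg2. replace (r ^ 2) with (1 - p ^ 2) by lra.
      replace (c ^ 2) with (1 - s ^ 2) by lra. ring.
    - field. lra. }
  destruct (dihedral_angle_frame (sg * side_sign (F i1)) 1 (P i3 (F i3)) (P i1 (F i1))
    (0, 0, 0, 1) (- sg * s * f / (c * r), sg * s * p / (c * r), f / r, 0) (P i2 sa) (P i2 sb)
    (sg * q1 / (1 - p ^ 2)) (- sg * p * q1 / (1 - p ^ 2)) (r1 / (s * r)) (g1 * r / r1) (q1 * f / r1)
    (sg * q2 / (1 - p ^ 2)) (- sg * p * q2 / (1 - p ^ 2)) (r2 / (s * r)) (g2 * r / r2) (q2 * f / r2)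
    X Y) as [phi [Hphi Ht]]; rewrite ?Hu, ?Hv; auto using is_sign_mul, side_sign_is_sign.
  all: clear HX HY HXY Hu Hv.
  - left; ring.
  - simpl; ring.
  - simpl. field_simplify_eq; [ | lra]. replace (f ^ 2) with (c ^ 2 - p ^ 2) by lra.
    rewrite Hsg2, hr2. replace (c ^ 2) with (1 - s ^ 2) by lra. ring.
  - simpl. ring.
  - simpl. ring.
  - simpl. ring.
  - simpl. field. lra.
  - simpl. field. lra.
  - unfold det4, det3.
    replace (1 * _) with r; [lra | ].
    field_simplify_eq; [ | lra].
    replace (r ^ 2) with (1 - p ^ 2) by lra. rewrite Hsg2.
    replace (f ^ 2) with (c ^ 2 - p ^ 2) by lra.
    replace (c ^ 2) with (1 - s ^ 2) by lra. ring.
  - now apply Hframe.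
  - now apply Hframe.
  - apply Rdiv_lt_0_compat; [lra | now apply Rmult_lt_0_compat].
  - apply Rdiv_lt_0_compat; [lra | now apply Rmult_lt_0_compat].
  - replace (_ + _) with (s ^ 2); [now apply pow_lt | ].
    field_simplify_eq; [ | lra]. rewrite hg1, hr2, hr12.
    replace (f ^ 2) with (1 - s ^ 2 - p ^ 2) by lra. ring.
  - exists phi. split; [exact Hphi | ]. simpl next. rewrite Ht. f_equal.
    ring_simplify. reflexivity.
Qed.

(** In the normal plane a_3 and b_3 project to (-f, -g) and (-f, g), mirror images in an axis of the
    frame, so the tangent of the half angle is g/f up to sign. *)
Lemma edge_t_3 :
  edge_t P F i3 (Pdiv (- (side_sign (F i1) * side_sign (F i2)) * sel (F i2) g1 g2)
                      (sel (F i1) f1 f2)).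
Proof.
  set (p := sel (F i1) p1 p2). set (f := sel (F i1) f1 f2).
  set (q := sel (F i2) q1 q2). set (g := sel (F i2) g1 g2).
  assert (hf : f ^ 2 = c ^ 2 - p ^ 2) by (unfold f, p; now destruct (F i1)).
  assert (hg : g ^ 2 = s ^ 2 - q ^ 2) by (unfold g, q; now destruct (F i2)).
  assert (h : 0 < 1 - p ^ 2 - q ^ 2)
    by (unfold p, q; destruct (F i1), (F i2); simpl sel; lra).
  assert (Hu : P i1 (F i1) = (p / c, f / c, 0, 0)) by (unfold p, f; now destruct (F i1)).
  assert (Hv : P i2 (F i2) = (0, 0, q / s, g / s)) by (unfold q, g; now destruct (F i2)).
  destruct (dihedral_angle_frame (side_sign (F i1) * side_sign (F i2)) 1
    (P i1 (F i1)) (P i2 (F i2)) (- f / c, p / c, 0, 0) (0, 0, - g / s, q / s) (P i3 sa) (P i3 sb)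
    p q 1 (- f) (- g) p (- q) 1 (- f) g f (- g)) as [phi [Hphi Ht]];
    rewrite ?Hu, ?Hv; auto using is_sign_mul, side_sign_is_sign.
  - left; ring.
  - simpl. field_simplify_eq; [ | lra]. rewrite hf. ring.
  - simpl. field_simplify_eq; [ | lra]. rewrite hg. ring.
  - simpl. ring.
  - simpl. field. lra.
  - simpl. ring.
  - simpl. ring.
  - simpl. field. lra.
  - unfold det4, det3. replace (1 * _) with 1; [lra | ].
    field_simplify_eq; [ | lra]. rewrite hf, hg. ring.
  - simpl. vec4_ext; try ring; field_simplify_eq; try lra; rewrite ?hf, ?hg; ring.
  - simpl. vec4_ext; try ring; field_simplify_eq; try lra; rewrite ?hf, ?hg; ring.
  - lra.
  - lra.
  - lra.
  - lra.
  - ring.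
  - ring.
  - exists phi. split; [exact Hphi | ]. simpl next. rewrite Ht. f_equal. ring.
Qed.

End Edges.

(** * The flexion *)

Definition admissible (p1 p2 q1 q2 : R) : Prop :=
  p1 ^ 2 < p2 ^ 2 /\ q1 ^ 2 < q2 ^ 2 /\ p2 ^ 2 + q2 ^ 2 < 1.

(** The cross ratio condition with denominators cleared. It is symmetric under exchanging the p_i
    with the q_i, so one modulus serves t_1 and t_2. *)
Definition admissible_modulus (k p1 p2 q1 q2 : R) : Prop :=
  landen_modulus k ^ 2 * ((1 - q1 ^ 2 - p2 ^ 2) * (1 - q2 ^ 2 - p1 ^ 2)) =
  (1 - q1 ^ 2 - p1 ^ 2) * (1 - q2 ^ 2 - p2 ^ 2).

Lemma admissible_swap (p1 p2 q1 q2 : R) : admissible p1 p2 q1 q2 -> admissible q1 q2 p1 p2.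
Proof. unfold admissible. lra. Qed.

Lemma admissible_modulus_swap (k p1 p2 q1 q2 : R) :
  admissible_modulus k p1 p2 q1 q2 -> admissible_modulus k q1 q2 p1 p2.
Proof. unfold admissible_modulus. intros H. lra. Qed.

Lemma admissible_bounds (p1 p2 q1 q2 : R) : admissible p1 p2 q1 q2 ->
  0 < 1 - q1 ^ 2 - p1 ^ 2 /\ 0 < 1 - q1 ^ 2 - p2 ^ 2 /\ 0 < 1 - q2 ^ 2 - p1 ^ 2 /\
  0 < 1 - q2 ^ 2 - p2 ^ 2 /\ 0 < q2 ^ 2 - q1 ^ 2 /\ 0 < p2 ^ 2 - p1 ^ 2 /\
  0 < 1 - q1 ^ 2 /\ 0 < 1 - q2 ^ 2.
Proof.
  unfold admissible. pose proof (pow2_ge_0 p1). pose proof (pow2_ge_0 q1). intros. lra.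
Qed.

(** The cross ratio is below 1 because its denominator exceeds its numerator by (q_2^2 -
    q_1^2)(p_2^2 - p_1^2). The map m |-> (1 - m)/(1 + m) is an involution, hence the choice of
    k'. *)
Lemma admissible_modulus_exists (p1 p2 q1 q2 : R) : admissible p1 p2 q1 q2 ->
  exists k, 0 < k < 1 /\ admissible_modulus k p1 p2 q1 q2.
Proof.
  intros H. destruct (admissible_bounds _ _ _ _ H) as (h11 & h12 & h21 & h22 & hq & hp & _).
  set (m2 := (1 - q1 ^ 2 - p1 ^ 2) * (1 - q2 ^ 2 - p2 ^ 2) /
             ((1 - q1 ^ 2 - p2 ^ 2) * (1 - q2 ^ 2 - p1 ^ 2))).
  assert (hd : 0 < (1 - q1 ^ 2 - p2 ^ 2) * (1 - q2 ^ 2 - p1 ^ 2))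
    by now apply Rmult_lt_0_compat.
  assert (hm2 : 0 < m2 < 1).
  { split.
    - apply Rdiv_lt_0_compat; [now apply Rmult_lt_0_compat | assumption].
    - apply Rmult_lt_reg_r with ((1 - q1 ^ 2 - p2 ^ 2) * (1 - q2 ^ 2 - p1 ^ 2)); [assumption | ].
      unfold m2, Rdiv. rewrite Rmult_assoc, Rinv_l by lra.
      assert (0 < (q2 ^ 2 - q1 ^ 2) * (p2 ^ 2 - p1 ^ 2)) by now apply Rmult_lt_0_compat.
      lra. }
  set (m := sqrt m2). assert (hm : m ^ 2 = m2) by (apply pow2_sqrt; lra).
  assert (hm0 : 0 < m) by (apply sqrt_lt_R0; lra). assert (hm1 : m < 1) by nra.
  set (k' := (1 - m) / (1 + m)).
  assert (hk' : 0 < k' < 1).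
  { unfold k'. split; [apply Rdiv_lt_0_compat; lra | ].
    apply Rmult_lt_reg_r with (1 + m); [lra | ].
    unfold Rdiv. rewrite Rmult_assoc, Rinv_l by lra. lra. }
  assert (hk2 : 0 < 1 - k' ^ 2 < 1) by nra.
  exists (sqrt (1 - k' ^ 2)). split.
  - split; [apply sqrt_lt_R0; lra | ]. rewrite <- sqrt_1 at 2. apply sqrt_lt_1_alt. lra.
  - assert (hc : compl_modulus (sqrt (1 - k' ^ 2)) = k').
    { unfold compl_modulus. rewrite pow2_sqrt by lra.
      replace (1 - (1 - k' ^ 2)) with (k' ^ 2) by ring. apply sqrt_pow2. lra. }
    unfold admissible_modulus, landen_modulus. rewrite hc.
    replace ((1 - k') / (1 + k')) with m by (unfold k'; field; lra).
    rewrite hm. unfold m2. field. lra.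
Qed.

(** * The heights as functions of the parameter *)

Definition height_scale (k p1 p2 q1 q2 u : R) : R :=
  sqrt (1 - q1 ^ 2 - p1 ^ 2) /
  sqrt ((1 - q2 ^ 2 - p1 ^ 2) * landen_dn k u ^ 2 + (q2 ^ 2 - q1 ^ 2)).

(** The constants are the values at u = 0, which is the position theta_min: there g_2 = 0 and the
    scale is 1. The extra quotient in [height_b2] is |g_2/g_1| at theta_max, where f_2 = 0. *)
Definition height_a1 (k p1 p2 q1 q2 u : R) : R :=
  height_scale k p1 p2 q1 q2 u * sqrt (1 - q2 ^ 2 - p1 ^ 2) * landen_dn k u.
Definition height_b1 (k p1 p2 q1 q2 u : R) : R :=
  height_scale k p1 p2 q1 q2 u * sqrt (1 - q2 ^ 2 - p2 ^ 2) * landen_cn k u.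
Definition height_a2 (k p1 p2 q1 q2 u : R) : R :=
  height_scale k p1 p2 q1 q2 u * sqrt (q2 ^ 2 - q1 ^ 2).
Definition height_b2 (k p1 p2 q1 q2 u : R) : R :=
  height_scale k p1 p2 q1 q2 u * sqrt (q2 ^ 2 - q1 ^ 2) *
  (sqrt (1 - q2 ^ 2 - p2 ^ 2) / sqrt (1 - q1 ^ 2 - p2 ^ 2)) * landen_sn k u.

Section Heights.

Context (k p1 p2 q1 q2 u : R) (hk : 0 < k < 1).
Context (hadm : admissible p1 p2 q1 q2) (hmod : admissible_modulus k p1 p2 q1 q2).

Lemma height_scale_pos : 0 < height_scale k p1 p2 q1 q2 u.
Proof.
  destruct (admissible_bounds _ _ _ _ hadm) as (h11 & h12 & h21 & h22 & hq & hp & h1 & h2).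
  pose proof (landen_dn_pos k u hk).
  apply Rdiv_lt_0_compat; apply sqrt_lt_R0; [assumption | ].
  apply Rplus_lt_0_compat; [ | assumption].
  apply Rmult_lt_0_compat; [assumption | now apply pow_lt].
Qed.

Lemma height_scale_sq :
  height_scale k p1 p2 q1 q2 u ^ 2 *
  ((1 - q2 ^ 2 - p1 ^ 2) * landen_dn k u ^ 2 + (q2 ^ 2 - q1 ^ 2)) = 1 - q1 ^ 2 - p1 ^ 2.
Proof.
  destruct (admissible_bounds _ _ _ _ hadm) as (h11 & h12 & h21 & h22 & hq & hp & h1 & h2).
  pose proof (landen_dn_pos k u hk).
  assert (0 < (1 - q2 ^ 2 - p1 ^ 2) * landen_dn k u ^ 2 + (q2 ^ 2 - q1 ^ 2)).
  { apply Rplus_lt_0_compat; [ | assumption].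
    apply Rmult_lt_0_compat; [assumption | now apply pow_lt]. }
  unfold height_scale, Rdiv. rewrite Rpow_mult_distr, pow_inv, !pow2_sqrt by lra.
  field. lra.
Qed.

Lemma height_a1_pos : 0 < height_a1 k p1 p2 q1 q2 u.
Proof.
  destruct (admissible_bounds _ _ _ _ hadm) as (h11 & h12 & h21 & h22 & hq & hp & h1 & h2).
  pose proof height_scale_pos. pose proof (landen_dn_pos k u hk).
  apply Rmult_lt_0_compat; [apply Rmult_lt_0_compat | ]; auto. now apply sqrt_lt_R0.
Qed.

Lemma height_a2_pos : 0 < height_a2 k p1 p2 q1 q2 u.
Proof.
  destruct (admissible_bounds _ _ _ _ hadm) as (h11 & h12 & h21 & h22 & hq & hp & h1 & h2).
  pose proof height_scale_pos.
  apply Rmult_lt_0_compat; auto. now apply sqrt_lt_R0.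
Qed.

(** Of the four relations f_i^2 + g_j^2 = 1 - p_i^2 - q_j^2 this one is the normalization of the
    scale; the next two rest on the modulus condition, and the fourth is a combination of the
    three. *)
Lemma height_a1_a2 :
  height_a1 k p1 p2 q1 q2 u ^ 2 + height_a2 k p1 p2 q1 q2 u ^ 2 = 1 - q1 ^ 2 - p1 ^ 2.
Proof.
  destruct (admissible_bounds _ _ _ _ hadm) as (h11 & h12 & h21 & h22 & hq & hp & h1 & h2).
  rewrite <- height_scale_sq. unfold height_a1, height_a2.
  rewrite !Rpow_mult_distr, !pow2_sqrt by lra. ring.
Qed.

Lemma height_b1_a2 :
  height_b1 k p1 p2 q1 q2 u ^ 2 + height_a2 k p1 p2 q1 q2 u ^ 2 = 1 - q1 ^ 2 - p2 ^ 2.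
Proof.
  destruct (admissible_bounds _ _ _ _ hadm) as (h11 & h12 & h21 & h22 & hq & hp & h1 & h2).
  pose proof height_scale_sq as H. unfold height_b1, height_a2.
  rewrite !Rpow_mult_distr, !pow2_sqrt by lra.
  apply Rmult_eq_reg_l with (1 - q1 ^ 2 - p1 ^ 2); [ | lra].
  rewrite <- H at 2.
  pose proof (landen_dn_sq k u hk) as Hd. pose proof (landen_sn2_cn2 k u hk) as Hc.
  unfold admissible_modulus in hmod.
  replace (landen_cn k u ^ 2) with (1 - landen_sn k u ^ 2) by lra. rewrite Hd.
  apply Rminus_diag_uniq.
  (* The difference of the two sides is a multiple of the modulus condition. *)
  transitivity (height_scale k p1 p2 q1 q2 u ^ 2 * landen_sn k u ^ 2 *
   (landen_modulus k ^ 2 * ((1 - q1 ^ 2 - p2 ^ 2) * (1 - q2 ^ 2 - p1 ^ 2)) -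
    (1 - q1 ^ 2 - p1 ^ 2) * (1 - q2 ^ 2 - p2 ^ 2))); [ring | ].
  rewrite hmod. ring.
Qed.

Lemma height_a1_b2 :
  height_a1 k p1 p2 q1 q2 u ^ 2 + height_b2 k p1 p2 q1 q2 u ^ 2 = 1 - q2 ^ 2 - p1 ^ 2.
Proof.
  destruct (admissible_bounds _ _ _ _ hadm) as (h11 & h12 & h21 & h22 & hq & hp & h1 & h2).
  pose proof height_scale_sq as H. unfold height_a1, height_b2, Rdiv.
  rewrite !Rpow_mult_distr, pow_inv, !pow2_sqrt by lra.
  apply Rmult_eq_reg_l with (1 - q1 ^ 2 - p1 ^ 2); [ | lra].
  rewrite <- H at 2.
  pose proof (landen_dn_sq k u hk) as Hd.
  unfold admissible_modulus in hmod. rewrite Hd.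
  apply Rminus_diag_uniq.
  transitivity (height_scale k p1 p2 q1 q2 u ^ 2 * landen_sn k u ^ 2 * (q2 ^ 2 - q1 ^ 2) /
    (1 - q1 ^ 2 - p2 ^ 2) *
   ((1 - q1 ^ 2 - p1 ^ 2) * (1 - q2 ^ 2 - p2 ^ 2) -
   landen_modulus k ^ 2 * ((1 - q1 ^ 2 - p2 ^ 2) * (1 - q2 ^ 2 - p1 ^ 2)))); [field; lra | ].
  rewrite hmod. ring.
Qed.

(** The positive square root of the modulus condition; it eliminates one radical in
    [half_angle_a2]. *)
Lemma modulus_root : landen_modulus k * (sqrt (1 - q1 ^ 2 - p2 ^ 2) * sqrt (1 - q2 ^ 2 - p1 ^ 2))
  = sqrt (1 - q1 ^ 2 - p1 ^ 2) * sqrt (1 - q2 ^ 2 - p2 ^ 2).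
Proof.
  destruct (admissible_bounds _ _ _ _ hadm) as (h11 & h12 & h21 & h22 & hq & hp & h1 & h2).
  pose proof (compl_modulus_bounds k hk).
  assert (0 < landen_modulus k) by (apply Rdiv_lt_0_compat; lra).
  rewrite <- !sqrt_mult by lra. rewrite <- hmod.
  rewrite (sqrt_mult (landen_modulus k ^ 2)).
  - rewrite sqrt_pow2 by lra. reflexivity.
  - apply pow2_ge_0.
  - left. now apply Rmult_lt_0_compat.
Qed.

End Heights.

Lemma landen_compl_sq (k : R) : 0 < k < 1 ->
  4 * compl_modulus k / (1 + compl_modulus k) ^ 2 = 1 - landen_modulus k ^ 2.
Proof.
  intros hk. pose proof (compl_modulus_bounds k hk). unfold landen_modulus. field. lra.
Qed.

Lemma sq_neq (x y : R) : x ^ 2 - y ^ 2 <> 0 -> x - y <> 0.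
Proof.
  intros H h. apply H. replace (x ^ 2 - y ^ 2) with ((x - y) * (x + y)) by ring.
  rewrite h. ring.
Qed.

Section Half_angles.

Context (k p1 p2 q1 q2 : R) (hk : 0 < k < 1).
Context (hadm : admissible p1 p2 q1 q2) (hmod : admissible_modulus k p1 p2 q1 q2).

(** The modulus condition in complementary form: the first factor is m'^2 = 1 - m^2, and the
    right-hand side is the difference of the two products in the cross ratio. *)
Lemma one_minus_modulus_sq :
  4 * compl_modulus k / (1 + compl_modulus k) ^ 2 *
  ((1 - q1 ^ 2 - p2 ^ 2) * (1 - q2 ^ 2 - p1 ^ 2)) = (q2 ^ 2 - q1 ^ 2) * (p2 ^ 2 - p1 ^ 2).
Proof.
  rewrite landen_compl_sq, Rmult_minus_distr_r by assumption.
  unfold admissible_modulus in hmod. rewrite hmod. ring.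
Qed.

(** Up to the common scale g is constant, and by [modulus_root] the sum f_1/r_1 + f_2/r_2 is
    proportional to dn + m cn of the Landen modulus, which is 2 dn u/(1 + k'). *)
Lemma half_angle_a2 : exists l, l <> 0 /\ forall u,
  half_angle p1 p2 (height_a1 k p1 p2 q1 q2 u) (height_b1 k p1 p2 q1 q2 u)
    q1 (height_a2 k p1 p2 q1 q2 u) (dn k u) l.
Proof.
  destruct (admissible_bounds _ _ _ _ hadm) as (h11 & h12 & h21 & h22 & hq & hp & h1 & h2).
  pose proof (compl_modulus_bounds k hk) as hk'.
  pose proof (modulus_root k p1 p2 q1 q2 hk hadm hmod) as hroot.
  pose proof one_minus_modulus_sq as hcompl.
  unfold half_angle, height_a1, height_a2, height_b1.
  assert (e11 := pow2_sqrt _ (Rlt_le _ _ h11)). assert (g11 := sqrt_lt_R0 _ h11).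
  assert (e12 := pow2_sqrt _ (Rlt_le _ _ h12)). assert (g12 := sqrt_lt_R0 _ h12).
  assert (e21 := pow2_sqrt _ (Rlt_le _ _ h21)). assert (g21 := sqrt_lt_R0 _ h21).
  assert (eq := pow2_sqrt _ (Rlt_le _ _ hq)). assert (gq := sqrt_lt_R0 _ hq).
  assert (e1 := pow2_sqrt _ (Rlt_le _ _ h1)). assert (g1 := sqrt_lt_R0 _ h1).
  set (r11 := sqrt (1 - q1 ^ 2 - p1 ^ 2)) in *. set (r12 := sqrt (1 - q1 ^ 2 - p2 ^ 2)) in *.
  set (r21 := sqrt (1 - q2 ^ 2 - p1 ^ 2)) in *. set (r22 := sqrt (1 - q2 ^ 2 - p2 ^ 2)) in *.
  set (rq := sqrt (q2 ^ 2 - q1 ^ 2)) in *. set (r1 := sqrt (1 - q1 ^ 2)) in *.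
  set (k' := compl_modulus k) in *.
  (* This value is read off from the second equation of [half_angle]; the first equation then
     amounts to [hdiff]. *)
  set (l := rq * (p2 / r12 - p1 / r11) * r11 * (1 + k') / (2 * r1 * r21)).
  assert (hr22 : r22 = (1 - k') / (1 + k') * r12 * r21 / r11).
  { field_simplify_eq; [ | lra]. unfold landen_modulus in hroot. fold k' in hroot.
    field_simplify_eq in hroot; lra. }
  assert (hdiff : (p2 / r12) ^ 2 - (p1 / r11) ^ 2 =
                  4 * k' / (1 + k') ^ 2 * r1 ^ 2 * r21 ^ 2 / rq ^ 2 / r11 ^ 2).
  { apply Rmult_eq_reg_r with (r12 ^ 2 * rq ^ 2 * r11 ^ 2); [ | apply Rgt_not_eq;
      repeat apply Rmult_lt_0_compat; lra].
    transitivity ((4 * k' / (1 + k') ^ 2 * (r12 ^ 2 * r21 ^ 2)) * r1 ^ 2); [ | field; lra].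
    transitivity ((p2 ^ 2 * r11 ^ 2 - p1 ^ 2 * r12 ^ 2) * rq ^ 2); [field; lra | ].
    rewrite e11, e12, e21, hcompl, e1, eq. ring. }
  (* The signs of p_1 and p_2 are unknown, but the squares differ by a positive amount. *)
  assert (hl0 : p2 / r12 - p1 / r11 <> 0).
  { apply sq_neq. rewrite hdiff. apply Rgt_not_eq.
    repeat (first [apply Rdiv_lt_0_compat | apply Rmult_lt_0_compat]);
    first [lra | now apply pow_lt | apply pow_lt; lra]. }
  exists l. split.
  - unfold l. apply Rmult_integral_contrapositive_currified;
      [ | apply Rinv_neq_0_compat; repeat apply Rmult_integral_contrapositive_currified; lra].
    repeat apply Rmult_integral_contrapositive_currified; lra.
  - intros u. pose proof (dn_pos k u hk) as hdn.
    rewrite hr22. unfold landen_dn, landen_cn. fold k'. unfold l.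
    set (H := height_scale k p1 p2 q1 q2 u). clearbody H. split.
    + apply Rminus_diag_uniq.
      transitivity (H / 2 * rq ^ 2 * r11 * (1 + k') / (r1 * r21) *
        (((p2 / r12) ^ 2 - (p1 / r11) ^ 2) -
         4 * k' / (1 + k') ^ 2 * r1 ^ 2 * r21 ^ 2 / rq ^ 2 / r11 ^ 2)); [field; lra | ].
      rewrite hdiff. ring.
    + field. lra.
Qed.

(** Here f_1/r_1 + f_2/r_2 and f_1/r_1 - f_2/r_2 are proportional to dn + cn and dn - cn of the
    Landen modulus, that is, to cn^2 u/dn u and sn^2 u/dn u, while g is proportional to sn u cn u/dn
    u. *)
Lemma half_angle_b2 : exists l, l <> 0 /\ forall u,
  half_angle p1 p2 (height_a1 k p1 p2 q1 q2 u) (height_b1 k p1 p2 q1 q2 u)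
    q2 (height_b2 k p1 p2 q1 q2 u) (cn k u) (l * sn k u).
Proof.
  destruct (admissible_bounds _ _ _ _ hadm) as (h11 & h12 & h21 & h22 & hq & hp & h1 & h2).
  pose proof (compl_modulus_bounds k hk) as hk'.
  pose proof one_minus_modulus_sq as hcompl.
  unfold half_angle, height_a1, height_b2, height_b1.
  assert (e12 := pow2_sqrt _ (Rlt_le _ _ h12)). assert (g12 := sqrt_lt_R0 _ h12).
  assert (e21 := pow2_sqrt _ (Rlt_le _ _ h21)). assert (g21 := sqrt_lt_R0 _ h21).
  assert (e22 := pow2_sqrt _ (Rlt_le _ _ h22)). assert (g22 := sqrt_lt_R0 _ h22).
  assert (eq := pow2_sqrt _ (Rlt_le _ _ hq)). assert (gq := sqrt_lt_R0 _ hq).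
  assert (e2 := pow2_sqrt _ (Rlt_le _ _ h2)). assert (g2 := sqrt_lt_R0 _ h2).
  set (r12 := sqrt (1 - q1 ^ 2 - p2 ^ 2)) in *.
  set (r21 := sqrt (1 - q2 ^ 2 - p1 ^ 2)) in *. set (r22 := sqrt (1 - q2 ^ 2 - p2 ^ 2)) in *.
  set (rq := sqrt (q2 ^ 2 - q1 ^ 2)) in *. set (r2 := sqrt (1 - q2 ^ 2)) in *.
  set (k' := compl_modulus k) in *.
  set (l := rq * (p2 / r22 - p1 / r21) * r22 * (1 + k') / (2 * r2 * r12)).
  assert (hdiff : (p2 / r22) ^ 2 - (p1 / r21) ^ 2 =
                  4 * k' / (1 + k') ^ 2 * r2 ^ 2 * r12 ^ 2 / rq ^ 2 / r22 ^ 2).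
  { apply Rmult_eq_reg_r with (r21 ^ 2 * rq ^ 2 * r22 ^ 2); [ | apply Rgt_not_eq;
      repeat apply Rmult_lt_0_compat; lra].
    transitivity ((4 * k' / (1 + k') ^ 2 * (r12 ^ 2 * r21 ^ 2)) * r2 ^ 2); [ | field; lra].
    transitivity ((p2 ^ 2 * r21 ^ 2 - p1 ^ 2 * r22 ^ 2) * rq ^ 2); [field; lra | ].
    rewrite e12, e21, e22, hcompl, e2, eq. ring. }
  assert (hl0 : p2 / r22 - p1 / r21 <> 0).
  { apply sq_neq. rewrite hdiff. apply Rgt_not_eq.
    repeat (first [apply Rdiv_lt_0_compat | apply Rmult_lt_0_compat]);
    first [lra | now apply pow_lt | apply pow_lt; lra]. }
  exists l. split.
  - unfold l. apply Rmult_integral_contrapositive_currified;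
      [ | apply Rinv_neq_0_compat; repeat apply Rmult_integral_contrapositive_currified; lra].
    repeat apply Rmult_integral_contrapositive_currified; lra.
  - intros u. pose proof (dn_pos k u hk) as hdn.
    pose proof (landen_dn_minus_cn k u hk) as Hminus.
    pose proof (landen_dn_plus_cn k u hk) as Hplus. fold k' in Hminus.
    unfold landen_sn. fold k'. unfold l.
    set (H := height_scale k p1 p2 q1 q2 u). clearbody H.
    set (x := landen_dn k u) in *. set (y := landen_cn k u) in *. clearbody x y.
    (* The factor dn u produces the products evaluated by [Hminus] and [Hplus]. *)
    split; apply (Rmult_eq_reg_r (dn k u)); try lra; apply Rminus_diag_uniq.
    + transitivity (- cn k u * H * r2 * ((x - y) * dn k u)
        + cn k u * H * rq ^ 2 / 2 * r22 ^ 2 * (1 + k') ^ 2 / (r2 * r12 ^ 2) *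
          ((p2 / r22) ^ 2 - (p1 / r21) ^ 2) * sn k u ^ 2); [field; lra | ].
      rewrite Hminus, hdiff. field. lra.
    + transitivity (H * rq * (p2 / r22 - p1 / r21) * r22 / r12 * (1 + k') * sn k u *
        (cn k u ^ 2 - (x + y) * dn k u / 2)); [field; lra | ].
      rewrite Hplus. field. lra.
Qed.

End Half_angles.

(** * The symmetry between the p_i and the q_i *)

Section Swap.

Context (k p1 p2 q1 q2 u : R) (hk : 0 < k < 1).
Context (hadm : admissible p1 p2 q1 q2) (hmod : admissible_modulus k p1 p2 q1 q2).

Let v := ellK k / 2 - u.

Lemma landen_refl :
  sqrt (q2 ^ 2 - q1 ^ 2) * sqrt (p2 ^ 2 - p1 ^ 2) =
  landen_dn k v * landen_dn k u * (sqrt (1 - q1 ^ 2 - p2 ^ 2) * sqrt (1 - q2 ^ 2 - p1 ^ 2)).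
Proof.
  destruct (admissible_bounds _ _ _ _ hadm) as (h11 & h12 & h21 & h22 & hq & hp & h1 & h2).
  pose proof (compl_modulus_bounds k hk) as hk'.
  unfold v. rewrite landen_dn_half_K_sub by assumption.
  rewrite <- !sqrt_mult by lra.
  rewrite <- (one_minus_modulus_sq k p1 p2 q1 q2 hk hmod). rewrite sqrt_mult_alt.
  - f_equal. rewrite sqrt_div_alt by nra. rewrite sqrt_pow2 by lra.
    rewrite sqrt_mult by lra. replace 4 with (2 ^ 2) by ring. rewrite sqrt_pow2 by lra.
    reflexivity.
  - apply Rdiv_le_0_compat; nra.
Qed.

(** The right side is f_1 up to sign, the left side the same height regarded as g_1 of the exchanged
    data. Both are positive, so it suffices to compare squares, where [landen_refl] links the two
    normalizations. *)
Lemma height_scale_swap :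
  height_scale k q1 q2 p1 p2 v * sqrt (p2 ^ 2 - p1 ^ 2) =
  height_scale k p1 p2 q1 q2 u * sqrt (1 - q2 ^ 2 - p1 ^ 2) * landen_dn k u.
Proof.
  destruct (admissible_bounds _ _ _ _ hadm) as (h11 & h12 & h21 & h22 & hq & hp & h1 & h2).
  pose proof (height_a1_pos k p1 p2 q1 q2 u hk hadm) as P1.
  pose proof (height_a2_pos k q1 q2 p1 p2 v hk (admissible_swap _ _ _ _ hadm)) as P2.
  pose proof (height_scale_sq k p1 p2 q1 q2 u hk hadm) as H1.
  pose proof (height_scale_sq k q1 q2 p1 p2 v hk (admissible_swap _ _ _ _ hadm)) as H2.
  pose proof (landen_dn_pos k u hk) as Pd. pose proof (landen_dn_pos k v hk) as Pv.
  pose proof landen_refl as Href. unfold height_a1, height_a2 in P1, P2.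
  apply (f_equal (fun x => x ^ 2)) in Href.
  rewrite !Rpow_mult_distr, !pow2_sqrt in Href by lra.
  apply Rsqr_inj; [lra | lra | ]. rewrite !Rsqr_pow2, !Rpow_mult_distr, !pow2_sqrt by lra.
  assert (E : 0 < (1 - q2 ^ 2 - p1 ^ 2) * landen_dn k u ^ 2 + (q2 ^ 2 - q1 ^ 2)).
  { apply Rplus_lt_0_compat; [ | assumption].
    apply Rmult_lt_0_compat; [assumption | now apply pow_lt]. }
  apply Rmult_eq_reg_r with ((1 - q2 ^ 2 - p1 ^ 2) * landen_dn k u ^ 2 + (q2 ^ 2 - q1 ^ 2));
    [ | lra].
  transitivity ((1 - q1 ^ 2 - p1 ^ 2) * ((1 - q2 ^ 2 - p1 ^ 2) * landen_dn k u ^ 2)).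
  2: { rewrite <- H1. ring. }
  replace (1 - q1 ^ 2 - p1 ^ 2) with (1 - p1 ^ 2 - q1 ^ 2) by ring. rewrite <- H2.
  transitivity (height_scale k q1 q2 p1 p2 v ^ 2 *
    ((p2 ^ 2 - p1 ^ 2) * (1 - q2 ^ 2 - p1 ^ 2) * landen_dn k u ^ 2 +
     (q2 ^ 2 - q1 ^ 2) * (p2 ^ 2 - p1 ^ 2))); [ring | ].
  rewrite Href. ring.
Qed.

Lemma height_a1_swap : height_a1 k p1 p2 q1 q2 u = height_a2 k q1 q2 p1 p2 v.
Proof. unfold height_a1, height_a2. now rewrite height_scale_swap. Qed.

Lemma height_b1_swap : height_b1 k p1 p2 q1 q2 u = height_b2 k q1 q2 p1 p2 v.
Proof.
  destruct (admissible_bounds _ _ _ _ hadm) as (h11 & h12 & h21 & h22 & hq & hp & h1 & h2).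
  unfold height_b1, height_b2. rewrite height_scale_swap.
  rewrite <- (landen_sn_half_K_sub k u hk). fold v.
  replace (1 - p2 ^ 2 - q2 ^ 2) with (1 - q2 ^ 2 - p2 ^ 2) by ring.
  replace (1 - p1 ^ 2 - q2 ^ 2) with (1 - q2 ^ 2 - p1 ^ 2) by ring.
  field. apply Rgt_not_eq. now apply sqrt_lt_R0.
Qed.

End Swap.

Lemma height_a2_swap (k p1 p2 q1 q2 u : R) : 0 < k < 1 ->
  admissible p1 p2 q1 q2 -> admissible_modulus k p1 p2 q1 q2 ->
  height_a2 k p1 p2 q1 q2 u = height_a1 k q1 q2 p1 p2 (ellK k / 2 - u).
Proof.
  intros hk hadm hmod.
  rewrite (height_a1_swap k q1 q2 p1 p2) by auto using admissible_swap, admissible_modulus_swap.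
  now rewrite half_K_sub_involutive.
Qed.

Lemma height_b2_swap (k p1 p2 q1 q2 u : R) : 0 < k < 1 ->
  admissible p1 p2 q1 q2 -> admissible_modulus k p1 p2 q1 q2 ->
  height_b2 k p1 p2 q1 q2 u = height_b1 k q1 q2 p1 p2 (ellK k / 2 - u).
Proof.
  intros hk hadm hmod.
  rewrite (height_b1_swap k q1 q2 p1 p2) by auto using admissible_swap, admissible_modulus_swap.
  now rewrite half_K_sub_involutive.
Qed.

(** * The path through all positions *)

Lemma continuous_pair {U V : UniformSpace} (f : R -> U) (g : R -> V) (x : R) :
  continuous f x -> continuous g x -> continuous (fun t => (f t, g t)) x.
Proof.
  intros Hf Hg. apply filterlim_locally. intros eps.
  generalize (filter_and _ _ (proj1 (filterlim_locally _ _) Hf eps)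
                (proj1 (filterlim_locally _ _) Hg eps)).
  apply filter_imp. intros y [H1 H2]. now split.
Qed.

(** Since [height_a1] and [height_a2] are positive, [d1] and [e1] are the signs at a_1 and a_2. The
    signs at b_1 and b_2 are theirs times those of [height_b1] and [height_b2]. *)
Definition path (k p1 p2 q1 q2 d1 e1 u : R) : octahedron :=
  position p1 p2 q1 q2
    (sqrt (p1 ^ 2 + height_a1 k p1 p2 q1 q2 u ^ 2))
    (sqrt (q1 ^ 2 + height_a2 k p1 p2 q1 q2 u ^ 2))
    (d1 * height_a1 k p1 p2 q1 q2 u) (d1 * height_b1 k p1 p2 q1 q2 u)
    (e1 * height_a2 k p1 p2 q1 q2 u) (e1 * height_b2 k p1 p2 q1 q2 u).

Lemma continuous_half_K_sub {V : UniformSpace} (f : R -> V) (k u : R) :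
  (forall v, continuous f v) -> continuous (fun v => f (ellK k / 2 - v)) u.
Proof.
  intros Hf. apply (continuous_comp (fun v => ellK k / 2 - v) f); [ | apply Hf].
  apply (ex_derive_continuous (V := R_NormedModule)). auto_derive. easy.
Qed.

Lemma octa_position (p1 p2 q1 q2 d1 d2 e1 e2 theta : R) :
  0 < cos theta -> 0 < sin theta ->
  octa p1 p2 q1 q2 d1 d2 e1 e2 theta =
  position p1 p2 q1 q2 (cos theta) (sin theta)
    (d1 * sqrt (cos theta ^ 2 - p1 ^ 2)) (d2 * sqrt (cos theta ^ 2 - p2 ^ 2))
    (e1 * sqrt (sin theta ^ 2 - q1 ^ 2)) (e2 * sqrt (sin theta ^ 2 - q2 ^ 2)).
Proof.
  intros hc hs.
  assert (H : forall p c, 0 < c -> sqrt (1 - p ^ 2 / c ^ 2) = sqrt (c ^ 2 - p ^ 2) / c).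
  { intros p c h. replace (1 - p ^ 2 / c ^ 2) with ((c ^ 2 - p ^ 2) / c ^ 2) by (field; lra).
    rewrite sqrt_div_alt by now apply pow_lt. rewrite sqrt_pow2 by lra. reflexivity. }
  apply functional_extensionality; intros i. apply functional_extensionality; intros sd.
  destruct i, sd; cbv beta iota delta [octa position sel]; rewrite ?H by assumption; auto;
    vec4_ext; auto; unfold Rdiv; ring.
Qed.

Lemma asin_le_acos_range (p q c s theta : R) :
  0 <= theta <= PI / 2 -> cos theta = c -> sin theta = s ->
  p ^ 2 <= c ^ 2 -> q ^ 2 <= s ^ 2 -> asin (Rabs q) <= theta <= acos (Rabs p).
Proof.
  intros ht hc hs hp hq. pose proof PI_RGT_0.
  assert (0 <= c) by (rewrite <- hc; apply cos_ge_0; lra).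
  assert (0 <= s) by (rewrite <- hs; apply sin_ge_0; lra).
  assert (Rabs p <= c) by (apply Rsqr_incr_0_var; [rewrite <- Rsqr_abs, !Rsqr_pow2 | ]; lra).
  assert (Rabs q <= s) by (apply Rsqr_incr_0_var; [rewrite <- Rsqr_abs, !Rsqr_pow2 | ]; lra).
  pose proof (Rabs_pos p). pose proof (Rabs_pos q).
  pose proof (COS_bound theta). pose proof (SIN_bound theta).
  pose proof (asin_bound (Rabs q)). pose proof (acos_bound (Rabs p)). split.
  - apply sin_incr_0; try lra. rewrite sin_asin; lra.
  - apply cos_decr_0; try lra. rewrite cos_acos; lra.
Qed.

Lemma sign_mul_abs (d x : R) : is_sign d -> exists d', is_sign d' /\ d * x = d' * sqrt (x ^ 2).
Proof.
  intros hd. assert (sqrt (x ^ 2) = Rabs x) as ->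
    by (rewrite <- Rsqr_pow2; apply sqrt_Rsqr_abs).
  destruct (Rle_or_lt 0 x).
  - exists d. now rewrite Rabs_pos_eq.
  - exists (- d). split; [now apply is_sign_opp | ]. rewrite Rabs_left by assumption. ring.
Qed.

Section Path.

Context (k p1 p2 q1 q2 d1 e1 : R) (hk : 0 < k < 1).
Context (hadm : admissible p1 p2 q1 q2) (hmod : admissible_modulus k p1 p2 q1 q2).
Context (hd1 : is_sign d1) (he1 : is_sign e1).

Let g := path k p1 p2 q1 q2 d1 e1.

Lemma ex_derive_landen (u : R) :
  ex_derive (landen_dn k) u /\ ex_derive (landen_cn k) u /\ ex_derive (landen_sn k) u.
Proof.
  pose proof (dn_pos k u hk).
  assert (ex_derive (fun x => dn k x) u) by (eexists; now apply is_derive_dn).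
  assert (ex_derive (fun x => sn k x) u) by (eexists; now apply is_derive_sn).
  assert (ex_derive (fun x => cn k x) u) by (eexists; now apply is_derive_cn).
  unfold landen_dn, landen_cn, landen_sn.
  repeat split; auto_derive; repeat split; auto; lra.
Qed.

Lemma ex_derive_height_scale (u : R) : ex_derive (height_scale k p1 p2 q1 q2) u.
Proof.
  destruct (admissible_bounds _ _ _ _ hadm) as (h11 & h12 & h21 & h22 & hq & hp & h1 & h2).
  destruct (ex_derive_landen u) as [Hd _]. pose proof (landen_dn_pos k u hk).
  unfold height_scale.
  set (b := 1 - q2 ^ 2 - p1 ^ 2) in *. set (c := q2 ^ 2 - q1 ^ 2) in *.
  assert (0 < b * landen_dn k u ^ 2 + c).
  { apply Rplus_lt_0_compat; [ | assumption].
    apply Rmult_lt_0_compat; [assumption | now apply pow_lt]. }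
  clearbody b c. auto_derive.
  replace (landen_dn k u * (landen_dn k u * 1)) with (landen_dn k u ^ 2) by ring.
  repeat split; auto. now apply Rgt_not_eq, sqrt_lt_R0.
Qed.

Lemma ex_derive_heights (u : R) :
  ex_derive (height_a1 k p1 p2 q1 q2) u /\ ex_derive (height_b1 k p1 p2 q1 q2) u /\
  ex_derive (height_a2 k p1 p2 q1 q2) u /\ ex_derive (height_b2 k p1 p2 q1 q2) u.
Proof.
  destruct (ex_derive_landen u) as (Hd & Hc & Hs). pose proof (ex_derive_height_scale u).
  unfold height_a1, height_b1, height_a2, height_b2.
  repeat split; auto_derive; auto.
Qed.

Lemma path_radii (u : R) :
  let c := sqrt (p1 ^ 2 + height_a1 k p1 p2 q1 q2 u ^ 2) in
  let s := sqrt (q1 ^ 2 + height_a2 k p1 p2 q1 q2 u ^ 2) in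
  0 < c /\ 0 < s /\ c ^ 2 + s ^ 2 = 1 /\
  height_a1 k p1 p2 q1 q2 u ^ 2 = c ^ 2 - p1 ^ 2 /\
  height_b1 k p1 p2 q1 q2 u ^ 2 = c ^ 2 - p2 ^ 2 /\
  height_a2 k p1 p2 q1 q2 u ^ 2 = s ^ 2 - q1 ^ 2 /\
  height_b2 k p1 p2 q1 q2 u ^ 2 = s ^ 2 - q2 ^ 2.
Proof.
  intros c s.
  pose proof (height_a1_pos k p1 p2 q1 q2 u hk hadm) as P1.
  pose proof (height_a2_pos k p1 p2 q1 q2 u hk hadm) as P2.
  pose proof (height_a1_a2 k p1 p2 q1 q2 u hk hadm) as E11.
  pose proof (height_b1_a2 k p1 p2 q1 q2 u hk hadm hmod) as E21.
  pose proof (height_a1_b2 k p1 p2 q1 q2 u hk hadm hmod) as E12.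
  apply (pow_lt _ 2) in P1. apply (pow_lt _ 2) in P2.
  pose proof (pow2_ge_0 p1). pose proof (pow2_ge_0 q1).
  assert (hc : c ^ 2 = p1 ^ 2 + height_a1 k p1 p2 q1 q2 u ^ 2) by (apply pow2_sqrt; lra).
  assert (hs : s ^ 2 = q1 ^ 2 + height_a2 k p1 p2 q1 q2 u ^ 2) by (apply pow2_sqrt; lra).
  split; [apply sqrt_lt_R0; lra | ]. split; [apply sqrt_lt_R0; lra | ].
  repeat split; lra.
Qed.

Lemma path_continuous (i : index) (sd : side) (u : R) : continuous (fun v => g v i sd) u.
Proof.
  destruct (ex_derive_heights u) as (H1 & H2 & H3 & H4).
  destruct (path_radii u) as (hc & hs & _).
  assert (C : forall f : R -> R, ex_derive f u -> continuous f u)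
    by (intros f; apply (ex_derive_continuous (V := R_NormedModule))).
  assert (Hc : ex_derive (fun u => sqrt (p1 ^ 2 + height_a1 k p1 p2 q1 q2 u ^ 2)) u).
  { set (a := p1 ^ 2). auto_derive. repeat split; auto.
    (* Positivity of the radicand is recovered from that of its root, since [sqrt] is 0 on
       nonpositive numbers. *)
    apply Rnot_le_lt. intros h. apply sqrt_neg_0 in h. unfold a in h. simpl in hc, h. lra. }
  assert (Hs : ex_derive (fun u => sqrt (q1 ^ 2 + height_a2 k p1 p2 q1 q2 u ^ 2)) u).
  { set (a := q1 ^ 2). auto_derive. repeat split; auto.
    apply Rnot_le_lt. intros h. apply sqrt_neg_0 in h. unfold a in h. simpl in hs, h. lra. }
  unfold g, path.
  set (c := fun u => sqrt (p1 ^ 2 + height_a1 k p1 p2 q1 q2 u ^ 2)) in *.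
  set (s := fun u => sqrt (q1 ^ 2 + height_a2 k p1 p2 q1 q2 u ^ 2)) in *.
  change (continuous (fun v => position p1 p2 q1 q2 (c v) (s v)
    (d1 * height_a1 k p1 p2 q1 q2 v) (d1 * height_b1 k p1 p2 q1 q2 v)
    (e1 * height_a2 k p1 p2 q1 q2 v) (e1 * height_b2 k p1 p2 q1 q2 v) i sd) u).
  assert (hc' : c u <> 0) by (unfold c; lra). assert (hs' : s u <> 0) by (unfold s; lra).
  change (ex_derive c u) in Hc. change (ex_derive s u) in Hs. clearbody c s.
  destruct i, sd; cbv beta iota delta [position sel]; repeat apply continuous_pair;
    try apply continuous_const; apply C; auto_derive; auto.
Qed.

Lemma path_in_flexion (u : R) : octa_flexion p1 p2 q1 q2 d1 e1 (g u).
Proof.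
  destruct (path_radii u) as (hc & hs & hcs & E1 & E2 & E3 & E4).
  pose proof (height_a1_pos k p1 p2 q1 q2 u hk hadm) as P1.
  pose proof (height_a2_pos k p1 p2 q1 q2 u hk hadm) as P2.
  unfold g, path.
  set (c := sqrt (p1 ^ 2 + height_a1 k p1 p2 q1 q2 u ^ 2)) in *.
  set (s := sqrt (q1 ^ 2 + height_a2 k p1 p2 q1 q2 u ^ 2)) in *.
  clearbody c s. assert (hc1 : 0 <= c <= 1) by nra.
  assert (Hcos : cos (acos c) = c) by (apply cos_acos; lra).
  assert (Hsin : sin (acos c) = s).
  { rewrite sin_acos by lra. rewrite <- (sqrt_pow2 s) by lra. f_equal. rewrite Rsqr_pow2. lra. }
  destruct (sign_mul_abs d1 (height_b1 k p1 p2 q1 q2 u) hd1) as [d2 [hd2 Hd2]].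
  destruct (sign_mul_abs e1 (height_b2 k p1 p2 q1 q2 u) he1) as [e2 [he2 He2]].
  assert (Hth : acos c <= PI / 2).
  { rewrite <- acos_0. apply Rnot_lt_le. intros h.
    pose proof (acos_bound c). pose proof (acos_bound 0).
    apply cos_decreasing_1 in h; try lra. rewrite Hcos, cos_acos in h; lra. }
  exists (acos c), d2, e2. split; [ | split; [assumption | split; [assumption | ]]].
  - apply (asin_le_acos_range p2 q2 c s); auto.
    + pose proof (acos_bound c). lra.
    + pose proof (pow2_ge_0 (height_b1 k p1 p2 q1 q2 u)). lra.
    + pose proof (pow2_ge_0 (height_b2 k p1 p2 q1 q2 u)). lra.
  - rewrite octa_position; rewrite ?Hcos, ?Hsin; auto.
    rewrite <- E1, <- E2, <- E3, <- E4, <- Hd2, <- He2, !(sqrt_pow2 (height_a1 _ _ _ _ _ _)),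
      !(sqrt_pow2 (height_a2 _ _ _ _ _ _)) by lra. reflexivity.
Qed.

(** A given position prescribes the scale H through g_1, and then the values x and y that
    [landen_cn] and [landen_sn] must take. They satisfy x^2 + y^2 = 1 because cos^2 + sin^2 = 1, so
    [landen_surj] provides the parameter. *)
Lemma path_surj (P : octahedron) : octa_flexion p1 p2 q1 q2 d1 e1 P -> exists u, g u = P.
Proof.
  intros (theta & d2 & e2 & Hth & hd2 & he2 & ->).
  destruct (admissible_bounds _ _ _ _ hadm) as (h11 & h12 & h21 & h22 & hq & hp & h1 & h2).
  pose proof PI_RGT_0 as Hpi.
  pose proof (pow2_ge_0 p1) as sp1. pose proof (pow2_ge_0 q1) as sq1.
  assert (hap : 0 < Rabs p2 < 1).
  { rewrite <- (pow2_abs p2) in hp, h12. pose proof (Rabs_pos p2). split; nra. }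
  assert (haq : 0 < Rabs q2 < 1).
  { rewrite <- (pow2_abs q2) in hq, h21. pose proof (Rabs_pos q2). split; nra. }
  (* As p_2 and q_2 are nonzero, theta stays strictly between 0 and PI/2, where cos and sin are
     positive. *)
  assert (Has : 0 < asin (Rabs q2)).
  { rewrite <- asin_0. apply Rnot_le_lt. intros h. pose proof (asin_bound (Rabs q2)).
    pose proof (asin_bound 0). apply sin_incr_1 in h; try lra. rewrite !sin_asin in h; lra. }
  assert (Hac : acos (Rabs p2) < PI / 2).
  { rewrite <- acos_0. apply Rnot_le_lt. intros h. pose proof (acos_bound (Rabs p2)).
    pose proof (acos_bound 0). apply cos_decr_1 in h; try lra. rewrite !cos_acos in h; lra. }
  assert (hc : Rabs p2 <= cos theta).
  { rewrite <- (cos_acos (Rabs p2)) by lra. pose proof (acos_bound (Rabs p2)).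
    apply cos_decr_1; lra. }
  assert (hs : Rabs q2 <= sin theta).
  { rewrite <- (sin_asin (Rabs q2)) by lra. pose proof (asin_bound (Rabs q2)).
    apply sin_incr_1; lra. }
  rewrite octa_position by lra.
  pose proof (sin2_cos2 theta) as hcs. rewrite !Rsqr_pow2 in hcs.
  set (c := cos theta) in *. set (s := sin theta) in *. clearbody c s.
  assert (hc2 : p2 ^ 2 <= c ^ 2) by (rewrite <- (pow2_abs p2); apply pow_incr; lra).
  assert (hs2 : q2 ^ 2 <= s ^ 2) by (rewrite <- (pow2_abs q2); apply pow_incr; lra).
  pose proof (is_sign_sq _ hd1) as hd1s. pose proof (is_sign_sq _ he1) as he1s.
  pose proof (is_sign_sq _ hd2) as hd2s. pose proof (is_sign_sq _ he2) as he2s.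
  assert (hP1 : 0 < c ^ 2 - p1 ^ 2) by lra. assert (hP2 : 0 <= c ^ 2 - p2 ^ 2) by lra.
  assert (hQ1 : 0 < s ^ 2 - q1 ^ 2) by lra. assert (hQ2 : 0 <= s ^ 2 - q2 ^ 2) by lra.
  assert (e12 := pow2_sqrt _ (Rlt_le _ _ h12)). assert (g12 := sqrt_lt_R0 _ h12).
  assert (e22 := pow2_sqrt _ (Rlt_le _ _ h22)). assert (g22 := sqrt_lt_R0 _ h22).
  assert (eq := pow2_sqrt _ (Rlt_le _ _ hq)). assert (gq := sqrt_lt_R0 _ hq).
  assert (eQ1 := pow2_sqrt _ (Rlt_le _ _ hQ1)). assert (gQ1 := sqrt_lt_R0 _ hQ1).
  assert (eP2 := pow2_sqrt _ hP2). assert (eQ2 := pow2_sqrt _ hQ2).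
  set (H := sqrt (s ^ 2 - q1 ^ 2) / sqrt (q2 ^ 2 - q1 ^ 2)).
  assert (hH : 0 < H) by now apply Rdiv_lt_0_compat.
  assert (hH2 : H ^ 2 * (q2 ^ 2 - q1 ^ 2) = s ^ 2 - q1 ^ 2).
  { rewrite <- eq, <- eQ1. unfold H. field. lra. }
  (* [path] multiplies by [d1] and [e1], which square to 1, so these factors leave the required [d2]
     and [e2]. *)
  set (x := d1 * d2 * sqrt (c ^ 2 - p2 ^ 2) / (H * sqrt (1 - q2 ^ 2 - p2 ^ 2))).
  set (y := e1 * e2 * sqrt (s ^ 2 - q2 ^ 2) * sqrt (1 - q1 ^ 2 - p2 ^ 2) /
            (H * sqrt (q2 ^ 2 - q1 ^ 2) * sqrt (1 - q2 ^ 2 - p2 ^ 2))).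
  assert (hy2 : y ^ 2 * ((s ^ 2 - q1 ^ 2) * (1 - q2 ^ 2 - p2 ^ 2)) =
                (s ^ 2 - q2 ^ 2) * (1 - q1 ^ 2 - p2 ^ 2)).
  { rewrite <- hH2. rewrite <- eq at 1. rewrite <- e22 at 1. rewrite <- eQ2 at 1.
    rewrite <- e12 at 1. unfold y. field_simplify_eq; [ | lra]. ring [he1s he2s]. }
  assert (hx2 : x ^ 2 * ((s ^ 2 - q1 ^ 2) * (1 - q2 ^ 2 - p2 ^ 2)) =
                (c ^ 2 - p2 ^ 2) * (q2 ^ 2 - q1 ^ 2)).
  { rewrite <- hH2. rewrite <- eq, <- e22, <- eP2.
    unfold x. field_simplify_eq; [ | lra]. ring [hd1s hd2s]. }
  assert (hpos : 0 < (s ^ 2 - q1 ^ 2) * (1 - q2 ^ 2 - p2 ^ 2)) by now apply Rmult_lt_0_compat.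
  assert (hxy : x ^ 2 + y ^ 2 = 1).
  { apply Rmult_eq_reg_r with ((s ^ 2 - q1 ^ 2) * (1 - q2 ^ 2 - p2 ^ 2)); [ | lra].
    rewrite Rmult_plus_distr_r, hx2, hy2. replace (c ^ 2) with (1 - s ^ 2) by lra. ring. }
  destruct (landen_surj k x y hk hxy) as (u & Hcn & Hsn). exists u.
  pose proof (height_scale_pos k p1 p2 q1 q2 u hk hadm) as Hs0.
  (* The scale depends on u only through the square of [landen_dn], hence through y^2, which was
     chosen to fit H. *)
  assert (Hscale : height_scale k p1 p2 q1 q2 u = H).
  { apply Rsqr_inj; [lra | lra | ]. rewrite !Rsqr_pow2.
    pose proof (height_scale_sq k p1 p2 q1 q2 u hk hadm) as E.
    rewrite (landen_dn_sq k u hk), Hsn in E. unfold admissible_modulus in hmod.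
    set (z := height_scale k p1 p2 q1 q2 u ^ 2) in *.
    set (m := landen_modulus k ^ 2) in *.
    assert (hm : (1 - q2 ^ 2 - p1 ^ 2) * m =
                 (1 - q1 ^ 2 - p1 ^ 2) * (1 - q2 ^ 2 - p2 ^ 2) / (1 - q1 ^ 2 - p2 ^ 2)).
    { rewrite <- hmod. field. lra. }
    apply Rmult_eq_reg_r with ((1 - q1 ^ 2 - p1 ^ 2) * (q2 ^ 2 - q1 ^ 2)); [ | apply Rgt_not_eq;
      now apply Rmult_lt_0_compat].
    transitivity ((s ^ 2 - q1 ^ 2) * (1 - q1 ^ 2 - p1 ^ 2)); [ | rewrite <- hH2; ring].
    rewrite <- E at 2.
    transitivity (z * ((1 - q2 ^ 2 - p1 ^ 2) * (s ^ 2 - q1 ^ 2)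
       - ((1 - q2 ^ 2 - p1 ^ 2) * m) * (y ^ 2 * ((s ^ 2 - q1 ^ 2) * (1 - q2 ^ 2 - p2 ^ 2))) /
         (1 - q2 ^ 2 - p2 ^ 2) + (q2 ^ 2 - q1 ^ 2) * (s ^ 2 - q1 ^ 2))); [ | field; lra].
    rewrite hm, hy2. field. lra. }
  assert (Ha2 : height_a2 k p1 p2 q1 q2 u = sqrt (s ^ 2 - q1 ^ 2)).
  { unfold height_a2. rewrite Hscale. unfold H. field. lra. }
  assert (Hb1 : height_b1 k p1 p2 q1 q2 u = d1 * d2 * sqrt (c ^ 2 - p2 ^ 2)).
  { unfold height_b1. rewrite Hscale, Hcn. unfold x. field. lra. }
  assert (Hb2 : height_b2 k p1 p2 q1 q2 u = e1 * e2 * sqrt (s ^ 2 - q2 ^ 2)).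
  { unfold height_b2. rewrite Hscale, Hsn. unfold y. field. lra. }
  assert (Ha1 : height_a1 k p1 p2 q1 q2 u = sqrt (c ^ 2 - p1 ^ 2)).
  { pose proof (height_a1_pos k p1 p2 q1 q2 u hk hadm).
    rewrite <- (sqrt_pow2 (height_a1 k p1 p2 q1 q2 u)) by lra. f_equal.
    pose proof (height_a1_a2 k p1 p2 q1 q2 u hk hadm) as E. rewrite Ha2, eQ1 in E. lra. }
  unfold g, path. rewrite Ha1, Ha2, Hb1, Hb2.
  rewrite eQ1, (pow2_sqrt (c ^ 2 - p1 ^ 2)) by lra.
  replace (p1 ^ 2 + (c ^ 2 - p1 ^ 2)) with (c ^ 2) by ring.
  replace (q1 ^ 2 + (s ^ 2 - q1 ^ 2)) with (s ^ 2) by ring.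
  rewrite !sqrt_pow2 by lra. f_equal; ring [hd1s he1s].
Qed.

Lemma parametrizes_path : parametrizes g (octa_flexion p1 p2 q1 q2 d1 e1).
Proof.
  repeat split.
  - apply path_continuous.
  - apply path_in_flexion.
  - apply path_surj.
Qed.

Lemma parametrizes_path_reflected :
  parametrizes (fun u => g (ellK k / 2 - u)) (octa_flexion p1 p2 q1 q2 d1 e1).
Proof.
  repeat split.
  - intros i sd u. apply (continuous_half_K_sub (fun v => g v i sd) k). intros v.
    apply path_continuous.
  - intros u. apply path_in_flexion.
  - intros P HP. destruct (path_surj P HP) as [u Hu]. exists (ellK k / 2 - u).
    now rewrite half_K_sub_involutive.
Qed.

End Path.

(** * The kinds *)

Lemma Pdiv_scale (a x y x' y' : R) : a <> 0 -> x = a * x' -> y = a * y' -> Pdiv x y = Pdiv x' y'.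
Proof.
  intros ha -> ->. unfold Pdiv.
  destruct (Req_EM_T (a * y') 0) as [h | h], (Req_EM_T y' 0) as [h' | h']; auto.
  - apply Rmult_integral in h. tauto.
  - exfalso. apply h. rewrite h'. ring.
  - f_equal. field. auto.
Qed.

Lemma Pdiv_1 (x : R) : Some x = Pdiv x 1.
Proof.
  unfold Pdiv. destruct (Req_EM_T 1 0); [lra | ]. f_equal. field.
Qed.

(** Most tangents match their model after inversion, with lambda = 1/l. The values 0 and infinity
    are covered; the hypothesis on the squares excludes 0/0. *)
Lemma Pinv_Pscale_Pdiv (l x y : R) : l <> 0 -> 0 < x ^ 2 + y ^ 2 ->
  sign_inv false true (Pscale (/ l) (Pdiv x y)) = Pdiv (l * y) x.
Proof.
  intros hl hxy. assert (hl' := Rinv_neq_0_compat _ hl). unfold sign_inv, Pdiv, Pscale, Pinv.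
  destruct (Req_EM_T y 0) as [hy | hy], (Req_EM_T x 0) as [hx | hx].
  - subst. lra.
  - f_equal. rewrite hy. field. assumption.
  - destruct (Req_EM_T (/ l * (x / y)) 0) as [h | h]; auto.
    exfalso. apply h. rewrite hx. field. auto.
  - destruct (Req_EM_T (/ l * (x / y)) 0) as [h | h].
    + exfalso. revert h. apply Rmult_integral_contrapositive_currified; [assumption | ].
      apply Rmult_integral_contrapositive_currified; [assumption | ].
      now apply Rinv_neq_0_compat.
    + f_equal. field. auto.
Qed.

Lemma Psub_cs_sc (a s c : R) :
  Psub (Pdiv c s) (Pdiv (a * s) c) = Pdiv (c ^ 2 - a * s ^ 2) (s * c).
Proof.
  unfold Psub, Pdiv.
  destruct (Req_EM_T s 0) as [hs | hs], (Req_EM_T c 0) as [hc | hc],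
    (Req_EM_T (s * c) 0) as [h | h]; auto; try (exfalso; apply h; subst; ring).
  - apply Rmult_integral in h. tauto.
  - f_equal. field. auto.
Qed.

Lemma is_sign_neq_0 (d : R) : is_sign d -> d <> 0.
Proof. intros [-> | ->]; lra. Qed.

Lemma sn_cn_scaled_pos (k l u : R) : l <> 0 -> 0 < cn k u ^ 2 + (l * sn k u) ^ 2.
Proof.
  intros hl. pose proof (sn2_cn2 k u). pose proof (pow2_ge_0 (cn k u)).
  assert (0 < l ^ 2) by (rewrite <- Rsqr_pow2; now apply Rsqr_pos_lt).
  rewrite Rpow_mult_distr. destruct (Req_dec (sn k u) 0) as [h | h].
  - rewrite h in *. lra.
  - assert (0 < sn k u ^ 2) by (rewrite <- Rsqr_pow2; now apply Rsqr_pos_lt). nra.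
Qed.

Section Path_edges.

Context (k p1 p2 q1 q2 d1 e1 : R) (hk : 0 < k < 1).
Context (hadm : admissible p1 p2 q1 q2) (hmod : admissible_modulus k p1 p2 q1 q2).
Context (hd1 : is_sign d1) (he1 : is_sign e1) (F : face).

Let g := path k p1 p2 q1 q2 d1 e1.

Ltac path_setup u :=
  destruct (path_radii k p1 p2 q1 q2 hk hadm hmod u) as (hc & hs & hcs & E1 & E2 & E3 & E4);
  destruct (admissible_bounds _ _ _ _ hadm) as (h11 & h12 & h21 & h22 & hq & hp & h1 & h2);
  pose proof (is_sign_sq _ hd1) as hd1s; pose proof (is_sign_sq _ he1) as he1s.

Lemma path_edge_1 : exists l, l <> 0 /\ forall u,
  edge_t (g u) F i1 (sel (F i2) (Pdiv l (dn k u)) (Pdiv (l * sn k u) (cn k u))).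
Proof.
  pose proof (is_sign_neq_0 _ (is_sign_mul _ _ hd1 he1)) as hde.
  destruct (half_angle_a2 k p1 p2 q1 q2 hk hadm hmod) as (la & hla & Ha).
  destruct (half_angle_b2 k p1 p2 q1 q2 hk hadm hmod) as (lb & hlb & Hb).
  exists (- side_sign (F i2) * (d1 * e1 * sel (F i2) la lb)). split.
  - pose proof (is_sign_neq_0 _ (is_sign_opp _ (side_sign_is_sign (F i2)))).
    apply Rmult_integral_contrapositive_currified; [assumption | ].
    apply Rmult_integral_contrapositive_currified; [assumption | ].
    now destruct (F i2).
  - intros u. path_setup u.
    pose proof (edge_t_1 p1 p2 q1 q2 _ _ (d1 * height_a1 k p1 p2 q1 q2 u)
      (d1 * height_b1 k p1 p2 q1 q2 u) (e1 * height_a2 k p1 p2 q1 q2 u)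
      (e1 * height_b2 k p1 p2 q1 q2 u) F hc hs hcs) as H.
    rewrite !Rpow_mult_distr, hd1s, he1s, !Rmult_1_l in H.
    specialize (H E1 E2 E3 E4 ltac:(lra) ltac:(lra) ltac:(lra) ltac:(lra)).
    destruct (F i2); cbn [sel] in *.
    + apply H.
      * pose proof (dn_pos k u hk). pose proof (pow2_ge_0 (d1 * e1 * la)).
        pose proof (pow_lt (dn k u) 2). lra.
      * now apply half_angle_signs.
    + replace (- side_sign sb * (d1 * e1 * lb) * sn k u)
        with (- side_sign sb * (d1 * e1 * (lb * sn k u))) by ring. apply H.
      * replace (d1 * e1 * (lb * sn k u)) with (d1 * e1 * lb * sn k u) by ring.
        apply sn_cn_scaled_pos. now apply Rmult_integral_contrapositive_currified.
      * now apply half_angle_signs.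
Qed.

(** The half-angle lemmas are applied to the exchanged data at K/2 - u, and the swap lemmas identify
    the heights there with those of the path. *)
Lemma path_edge_2 : exists l, l <> 0 /\ forall u,
  edge_t (g u) F i2 (sel (F i1) (Pdiv l (dn k (ellK k / 2 - u)))
    (Pdiv (l * sn k (ellK k / 2 - u)) (cn k (ellK k / 2 - u)))).
Proof.
  pose proof (is_sign_neq_0 _ (is_sign_mul _ _ he1 hd1)) as hde.
  pose proof (admissible_swap _ _ _ _ hadm) as hadm'.
  pose proof (admissible_modulus_swap _ _ _ _ _ hmod) as hmod'.
  destruct (half_angle_a2 k q1 q2 p1 p2 hk hadm' hmod') as (la & hla & Ha).
  destruct (half_angle_b2 k q1 q2 p1 p2 hk hadm' hmod') as (lb & hlb & Hb).
  exists (side_sign (F i3) * side_sign (F i1) * (e1 * d1 * sel (F i1) la lb)). split.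
  - pose proof (is_sign_neq_0 _ (is_sign_mul _ _ (side_sign_is_sign (F i3))
      (side_sign_is_sign (F i1)))).
    apply Rmult_integral_contrapositive_currified; [assumption | ].
    apply Rmult_integral_contrapositive_currified; [assumption | ].
    now destruct (F i1).
  - intros u. path_setup u.
    pose proof (edge_t_2 p1 p2 q1 q2 _ _ (d1 * height_a1 k p1 p2 q1 q2 u)
      (d1 * height_b1 k p1 p2 q1 q2 u) (e1 * height_a2 k p1 p2 q1 q2 u)
      (e1 * height_b2 k p1 p2 q1 q2 u) F hc hs hcs) as H.
    rewrite !Rpow_mult_distr, hd1s, he1s, !Rmult_1_l in H.
    specialize (H E1 E2 E3 E4 ltac:(lra) ltac:(lra) ltac:(lra) ltac:(lra)).
    specialize (Ha (ellK k / 2 - u)). specialize (Hb (ellK k / 2 - u)).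
    rewrite <- (height_a1_swap k p1 p2 q1 q2 u), <- (height_b1_swap k p1 p2 q1 q2 u),
      <- (height_a2_swap k p1 p2 q1 q2 u), <- (height_b2_swap k p1 p2 q1 q2 u) in * by assumption.
    set (v := ellK k / 2 - u) in *.
    destruct (F i1); cbn [sel] in *.
    + apply H.
      * pose proof (dn_pos k v hk). pose proof (pow2_ge_0 (e1 * d1 * la)).
        pose proof (pow_lt (dn k v) 2). lra.
      * now apply half_angle_signs.
    + replace (side_sign (F i3) * side_sign sb * (e1 * d1 * lb) * sn k v)
        with (side_sign (F i3) * side_sign sb * (e1 * d1 * (lb * sn k v))) by ring. apply H.
      * replace (e1 * d1 * (lb * sn k v)) with (e1 * d1 * lb * sn k v) by ring.
        apply sn_cn_scaled_pos. now apply Rmult_integral_contrapositive_currified.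
      * now apply half_angle_signs.
Qed.

(** In a quotient of heights the common scale cancels, leaving 1/dn, sn/dn, 1/cn and sn/cn of the
    Landen modulus up to constants. The second is turned by the reflection into a multiple of cn at
    K_m - U, which gives it the form of the second model. *)
Lemma path_edge_3 : exists l, l <> 0 /\ forall u,
  edge_t (g u) F i3
    (sel (F i1)
      (sel (F i2) (Pdiv l (dn k u + compl_modulus k / dn k u))
         (Pdiv (l * (dn k (ellK k / 2 - u) - compl_modulus k / dn k (ellK k / 2 - u))) 1))
      (sel (F i2) (Pdiv l (dn k u - compl_modulus k / dn k u))
         (Pdiv (l * (sn k u * cn k u)) (cn k u ^ 2 - compl_modulus k * sn k u ^ 2)))).
Proof.
  pose proof (compl_modulus_bounds k hk) as hk'.
  pose proof (is_sign_neq_0 _ (is_sign_mul _ _ hd1 he1)) as hde.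
  pose proof (is_sign_neq_0 _ hd1) as hd0. pose proof (is_sign_neq_0 _ he1) as he0.
  set (sg := - (side_sign (F i1) * side_sign (F i2))).
  assert (hsg : sg <> 0).
  { apply is_sign_neq_0, is_sign_opp. auto using is_sign_mul, side_sign_is_sign. }
  assert (H : forall u, edge_t (g u) F i3
    (Pdiv (sg * sel (F i2) (e1 * height_a2 k p1 p2 q1 q2 u) (e1 * height_b2 k p1 p2 q1 q2 u))
       (sel (F i1) (d1 * height_a1 k p1 p2 q1 q2 u) (d1 * height_b1 k p1 p2 q1 q2 u)))).
  { intros u. path_setup u. unfold sg.
    apply (edge_t_3 p1 p2 q1 q2 _ _ (d1 * height_a1 k p1 p2 q1 q2 u)
      (d1 * height_b1 k p1 p2 q1 q2 u) (e1 * height_a2 k p1 p2 q1 q2 u)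
      (e1 * height_b2 k p1 p2 q1 q2 u) F);
      rewrite ?Rpow_mult_distr, ?hd1s, ?he1s, ?Rmult_1_l; auto; lra. }
  destruct (admissible_bounds _ _ _ _ hadm) as (h11 & h12 & h21 & h22 & hq & hp & h1 & h2).
  pose proof (is_sign_sq _ hd1) as hd1s.
  assert (g12 := sqrt_lt_R0 _ h12). assert (g21 := sqrt_lt_R0 _ h21).
  assert (g22 := sqrt_lt_R0 _ h22). assert (gq := sqrt_lt_R0 _ hq).
  assert (gp := sqrt_lt_R0 _ hp).
  clearbody sg.
  assert (Hlift : forall (P : R -> R -> RP1), (exists l, l <> 0 /\ forall u,
      Pdiv (sg * sel (F i2) (e1 * height_a2 k p1 p2 q1 q2 u) (e1 * height_b2 k p1 p2 q1 q2 u))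
       (sel (F i1) (d1 * height_a1 k p1 p2 q1 q2 u) (d1 * height_b1 k p1 p2 q1 q2 u)) = P l u) ->
      exists l, l <> 0 /\ forall u, edge_t (g u) F i3 (P l u)).
  { intros P (l & hl & Hl). exists l. split; [assumption | ]. intros u. rewrite <- Hl. apply H. }
  apply (Hlift (fun l u => sel (F i1) (sel (F i2) _ _) (sel (F i2) _ _))). clear H Hlift.
  destruct (F i1), (F i2); cbn [sel].
  - exists (sg * d1 * e1 * (sqrt (q2 ^ 2 - q1 ^ 2) * (1 + compl_modulus k) /
      sqrt (1 - q2 ^ 2 - p1 ^ 2))). split.
    + apply Rmult_integral_contrapositive_currified;
        [now repeat apply Rmult_integral_contrapositive_currified | ].
      apply Rgt_not_eq, Rdiv_lt_0_compat; [apply Rmult_lt_0_compat | ]; lra.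
    + intros u. pose proof (height_scale_pos k p1 p2 q1 q2 u hk hadm).
      pose proof (dn_pos k u hk).
      apply (Pdiv_scale (d1 * (height_scale k p1 p2 q1 q2 u * sqrt (1 - q2 ^ 2 - p1 ^ 2) /
        (1 + compl_modulus k)))).
      * apply Rmult_integral_contrapositive_currified; [assumption | ].
        apply Rgt_not_eq, Rdiv_lt_0_compat; [apply Rmult_lt_0_compat | ]; lra.
      * unfold height_a2. field_simplify_eq; [ | lra]. ring [hd1s].
      * unfold height_a1, landen_dn. field. lra.
  - exists (sg * d1 * e1 * (sqrt (1 - q2 ^ 2 - p2 ^ 2) / (1 - compl_modulus k) /
      sqrt (p2 ^ 2 - p1 ^ 2))). split.
    + apply Rmult_integral_contrapositive_currified;
        [now repeat apply Rmult_integral_contrapositive_currified | ].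
      apply Rgt_not_eq. repeat apply Rdiv_lt_0_compat; lra.
    + intros u. rewrite height_a1_swap, height_b2_swap by assumption.
      set (v := ellK k / 2 - u).
      pose proof (height_scale_pos k q1 q2 p1 p2 v hk (admissible_swap _ _ _ _ hadm)).
      pose proof (dn_pos k v hk).
      apply (Pdiv_scale (d1 * (height_scale k q1 q2 p1 p2 v * sqrt (p2 ^ 2 - p1 ^ 2)))).
      * apply Rmult_integral_contrapositive_currified; [assumption | ].
        apply Rgt_not_eq, Rmult_lt_0_compat; lra.
      * unfold height_b1, landen_cn.
        replace (1 - p2 ^ 2 - q2 ^ 2) with (1 - q2 ^ 2 - p2 ^ 2) by ring.
        field_simplify_eq; [ | lra]. ring [hd1s].
      * unfold height_a2. ring.
  - exists (sg * d1 * e1 * (sqrt (q2 ^ 2 - q1 ^ 2) * (1 - compl_modulus k) /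
      sqrt (1 - q2 ^ 2 - p2 ^ 2))). split.
    + apply Rmult_integral_contrapositive_currified;
        [now repeat apply Rmult_integral_contrapositive_currified | ].
      apply Rgt_not_eq, Rdiv_lt_0_compat; [apply Rmult_lt_0_compat | ]; lra.
    + intros u. pose proof (height_scale_pos k p1 p2 q1 q2 u hk hadm).
      pose proof (dn_pos k u hk).
      apply (Pdiv_scale (d1 * (height_scale k p1 p2 q1 q2 u * sqrt (1 - q2 ^ 2 - p2 ^ 2) /
        (1 - compl_modulus k)))).
      * apply Rmult_integral_contrapositive_currified; [assumption | ].
        apply Rgt_not_eq, Rdiv_lt_0_compat; [apply Rmult_lt_0_compat | ]; lra.
      * unfold height_a2. field_simplify_eq; [ | lra]. ring [hd1s].
      * unfold height_b1, landen_cn. field. lra.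
  - exists (sg * d1 * e1 * (sqrt (q2 ^ 2 - q1 ^ 2) * (1 + compl_modulus k) /
      sqrt (1 - q1 ^ 2 - p2 ^ 2))). split.
    + apply Rmult_integral_contrapositive_currified;
        [now repeat apply Rmult_integral_contrapositive_currified | ].
      apply Rgt_not_eq, Rdiv_lt_0_compat; [apply Rmult_lt_0_compat | ]; lra.
    + intros u. pose proof (height_scale_pos k p1 p2 q1 q2 u hk hadm).
      pose proof (dn_pos k u hk).
      pose proof (dn_sq_compl k u hk) as D2. pose proof (sn2_cn2 k u) as C2.
      apply (Pdiv_scale (d1 * (height_scale k p1 p2 q1 q2 u * sqrt (1 - q2 ^ 2 - p2 ^ 2) /
        dn k u))).
      * apply Rmult_integral_contrapositive_currified; [assumption | ].
        apply Rgt_not_eq, Rdiv_lt_0_compat; [apply Rmult_lt_0_compat | ]; lra.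
      * unfold height_b2, landen_sn. field_simplify_eq; [ | lra]. ring [hd1s].
      * unfold height_b1, landen_cn. field_simplify_eq; [ | lra]. rewrite D2, C2. ring.
Qed.

End Path_edges.

Definition by_index {T : Type} (x y z : T) (j : index) : T :=
  match j with i1 => x | i2 => y | i3 => z end.

Lemma pos_sq_sum (x : R) : 0 < x ^ 2 + 1 ^ 2.
Proof. pose proof (pow2_ge_0 x). lra. Qed.

Lemma cn_sn_sq_pos (k u : R) : 0 < cn k u ^ 2 + sn k u ^ 2.
Proof. rewrite sn2_cn2. lra. Qed.

Section Kinds.

Context (k p1 p2 q1 q2 d1 e1 : R) (hk : 0 < k < 1).
Context (hadm : admissible p1 p2 q1 q2) (hmod : admissible_modulus k p1 p2 q1 q2).
Context (hd1 : is_sign d1) (he1 : is_sign e1) (s3 : side).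

Let X := octa_flexion p1 p2 q1 q2 d1 e1.

Ltac edges F :=
  destruct (path_edge_1 k p1 p2 q1 q2 d1 e1 hk hadm hmod hd1 he1 F) as (l1 & hl1 & H1);
  destruct (path_edge_2 k p1 p2 q1 q2 d1 e1 hk hadm hmod hd1 he1 F) as (l2 & hl2 & H2);
  destruct (path_edge_3 k p1 p2 q1 q2 d1 e1 hk hadm hmod hd1 he1 F) as (l3 & hl3 & H3);
  cbn [mkface sel] in H1, H2, H3.

Lemma first_kind_a1_a2 : first_kind X (mkface sa sa s3).
Proof.
  edges (mkface sa sa s3).
  exists k, (by_index (/ l1) (/ l2) (/ l3)), (fun _ => false), (fun _ => true), false,
    (path k p1 p2 q1 q2 d1 e1).
  split; [assumption | ]. split; [intros []; now apply Rinv_neq_0_compat | ].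
  split; [now apply parametrizes_path | ].
  intros u []; cbn [swap12 by_index first_kind_fun];
    rewrite Pdiv_1, Pinv_Pscale_Pdiv, Rmult_1_r by auto using pos_sq_sum.
  - apply H1.
  - rewrite dn_half_K_even by assumption. apply H2.
  - apply H3.
Qed.

Lemma second_kind_b1_a2 : second_kind X (mkface sb sa s3).
Proof.
  edges (mkface sb sa s3).
  (* The model has u - K/2 where [path_edge_2] has K/2 - u; as sn is odd, [l2] changes sign. *)
  exists k, (by_index (/ l1) (/ - l2) (/ l3)), (fun _ => false), (fun _ => true), false,
    (path k p1 p2 q1 q2 d1 e1).
  split; [assumption | ].
  split; [intros []; apply Rinv_neq_0_compat; auto using Ropp_neq_0_compat | ].
  split; [now apply parametrizes_path | ].
  intros u []; cbn [swap12 by_index second_kind_fun].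
  - rewrite Pdiv_1, Pinv_Pscale_Pdiv, Rmult_1_r by auto using pos_sq_sum. apply H1.
  - rewrite Pinv_Pscale_Pdiv by auto using cn_sn_sq_pos, Ropp_neq_0_compat.
    rewrite cn_half_K_even, sn_half_K_odd, Rmult_opp_opp by assumption. apply H2.
  - rewrite Pdiv_1, Pinv_Pscale_Pdiv, Rmult_1_r by auto using pos_sq_sum. apply H3.
Qed.

(* The reflection [u |-> K/2 - u] exchanges the roles of [t_1] and [t_2]. *)
Lemma second_kind_a1_b2 : second_kind X (mkface sa sb s3).
Proof.
  edges (mkface sa sb s3).
  (* [lambda] is indexed after the swap, so its first entry belongs to t_2. For this face t_3 agrees
     with the model without inversion. *)
  exists k, (by_index (/ l2) (/ - l1) l3), (fun _ => false), (by_index true true false), true,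
    (fun u => path k p1 p2 q1 q2 d1 e1 (ellK k / 2 - u)).
  split; [assumption | ].
  split; [intros []; cbn; auto using Rinv_neq_0_compat, Ropp_neq_0_compat | ].
  split; [now apply parametrizes_path_reflected | ].
  intros u. specialize (H1 (ellK k / 2 - u)). specialize (H2 (ellK k / 2 - u)).
  specialize (H3 (ellK k / 2 - u)). rewrite half_K_sub_involutive in H2, H3.
  intros []; cbn [swap12 by_index second_kind_fun].
  - rewrite Pinv_Pscale_Pdiv by auto using cn_sn_sq_pos, Ropp_neq_0_compat.
    rewrite cn_half_K_even, sn_half_K_odd, Rmult_opp_opp by assumption. apply H1.
  - rewrite Pdiv_1, Pinv_Pscale_Pdiv, Rmult_1_r by auto using pos_sq_sum. apply H2.
  - cbn [sign_inv Pscale]. rewrite Pdiv_1. apply H3.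
Qed.

Lemma third_kind_b1_b2 : third_kind X (mkface sb sb s3).
Proof.
  edges (mkface sb sb s3). pose proof (compl_modulus_bounds k hk).
  exists k, (by_index (/ l1) (/ - l2) (/ l3)), (fun _ => false), (fun _ => true), false,
    (path k p1 p2 q1 q2 d1 e1).
  split; [assumption | ].
  split; [intros []; apply Rinv_neq_0_compat; auto using Ropp_neq_0_compat | ].
  split; [now apply parametrizes_path | ].
  intros u []; cbn [swap12 by_index third_kind_fun].
  - rewrite Pinv_Pscale_Pdiv by auto using cn_sn_sq_pos. apply H1.
  - rewrite Pinv_Pscale_Pdiv by auto using cn_sn_sq_pos, Ropp_neq_0_compat.
    rewrite cn_half_K_even, sn_half_K_odd, Rmult_opp_opp by assumption. apply H2.
  - pose proof (sn2_cn2 k u) as C2. rewrite Psub_cs_sc.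
    rewrite Pinv_Pscale_Pdiv; [apply H3 | assumption | ].
    (* Where sn u cn u vanishes the numerator does not: it is 1 at the zeros of sn and -k' at those
       of cn. *)
    destruct (Req_dec (sn k u * cn k u) 0) as [h | h].
    + apply Rmult_integral in h. destruct h as [h | h]; rewrite h in *.
      * replace (cn k u ^ 2) with 1 by lra. lra.
      * replace (sn k u ^ 2) with 1 by lra.
        replace (_ + _) with (compl_modulus k ^ 2) by ring. apply pow_lt. lra.
    + pose proof (Rsqr_pos_lt _ h) as h'. rewrite Rsqr_pow2 in h'.
      pose proof (pow2_ge_0 (cn k u ^ 2 - compl_modulus k * sn k u ^ 2)). lra.
Qed.

End Kinds.

Theorem proposition7p1 :
  forall p1 p2 q1 q2 d1 e1 : R,
    Rabs p1 < Rabs p2 ->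
    Rabs q1 < Rabs q2 ->
    p2 ^ 2 + q2 ^ 2 < 1 ->
    is_sign d1 ->
    is_sign e1 ->
    let X := octa_flexion p1 p2 q1 q2 d1 e1 in
    (first_kind X (mkface sa sa sa) /\ first_kind X (mkface sa sa sb)) /\
    (second_kind X (mkface sa sb sa) /\ second_kind X (mkface sa sb sb) /\
     second_kind X (mkface sb sa sa) /\ second_kind X (mkface sb sa sb)) /\
    (third_kind X (mkface sb sb sa) /\ third_kind X (mkface sb sb sb)).
Proof.
  intros p1 p2 q1 q2 d1 e1 hp hq h hd1 he1 X.
  assert (hadm : admissible p1 p2 q1 q2).
  { apply Rsqr_lt_abs_1 in hp, hq. rewrite !Rsqr_pow2 in hp, hq. now repeat split. }
  destruct (admissible_modulus_exists _ _ _ _ hadm) as (k & hk & hmod).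
  repeat split;
    eauto using first_kind_a1_a2, second_kind_a1_b2, second_kind_b1_a2, third_kind_b1_b2.
Qed.
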